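(* Let $X=X_{\infty,0}$ be a set consisting of distinct points $x_0$ and $x_{i,j}$ ($i,j\in\mathbb N$), and let $\phi=\phi_{\infty,0}\colon X\to X$ be given by $\phi(x_0)=x_0$, $\phi(x_{i,1})=x_0$ for $i\in\mathbb N$, and $\phi(x_{i,j})=x_{i,j-1}$ for $i\in\mathbb N$ and $j\ge2$. Then there exists a discrete measure $\mu$ on $X$ such that the composition operator $C_\phi$ in $L^2(\mu)$ has the following properties: (i) $C_\phi$ is injective and generates Stieltjes moment sequences, (ii) $C_\phi$ is not hyponormal, (iii) $\{\mathsf h_{\phi^n}(x_0)\}_{n=0}^\infty$ is an H-determinate Stieltjes moment sequence with index of H-determinacy at $0$ equal to $0$, (iv) $\{\mathsf h_{\phi^n}(x)\}_{n=0}^\infty$ is an H-determinate Stieltjes moment sequence with infinite index of H-determinacy for all $x\in X\setminus\{x_0\}$.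
   Context: Notation: $\mathbb N=\{1,2,\ldots\}$, $\mathbb Z_+=\{0,1,2,\ldots\}$, $\mathbb R_+=[0,\infty)$; $0^0=1$. All measures are positive. Moments. Let $\mathscr M$ be the set of Borel measures $\nu$ on $\mathbb R$ with $\int_{\mathbb R}|t|^n\,d\nu(t)<\infty$ for all $n\in\mathbb Z_+$, and $\mathscr M^+$ the set of those $\nu\in\mathscr M$ with closed support contained in $\mathbb R_+$. A real sequence $\{\gamma_n\}_{n=0}^\infty$ is a Hamburger (resp. Stieltjes) moment sequence if there is $\nu\in\mathscr M$ (resp. $\nu\in\mathscr M^+$) with $\gamma_n=\int_{\mathbb R}t^n\,d\nu(t)$ for all $n\in\mathbb Z_+$; such $\nu$ are called its H-representing (resp. S-representing) measures. A Hamburger moment sequence is H-determinate if it has exactly one H-representing measure; a measure in $\mathscr M$ is H-determinate if its moment sequence is. The index of H-determinacy of an H-determinate measure $\rho$ at $z\in\mathbb C$ is $\mathrm{ind}_z(\rho)=\sup\{k\in\mathbb Z_+: |t-z|^{2k}d\rho(t)\text{ is H-determinate}\}\in\mathbb Z_+\cup\{\infty\}$. The index of an H-determinate moment sequence at $z$ is that of its unique H-representing measure; it has infinite index of H-determinacy if its index is $\infty$ at some (equivalently, every) $z\in\mathbb C$. Operators. A discrete measure on a nonempty set $X$ is a $\sigma$-finite measure $\mu$ on $2^X$ with $\mu(x):=\mu(\{x\})>0$ for all $x\in X$ (so $\mu(x)<\infty$ as well). For $\phi\colon X\to X$, the composition operator $C_\phi$ in $L^2(\mu)$ has domain $\{f\in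 L^2(\mu): f\circ\phi\in L^2(\mu)\}$ and $C_\phi f=f\circ\phi$. For $n\in\mathbb Z_+$, $\mathsf h_{\phi^n}(x)=\mu((\phi^n)^{-1}(\{x\}))/\mu(x)\in[0,\infty]$. For an operator $A$ in a Hilbert space $\mathcal H$ with domain $\mathcal D(A)$, $\mathcal D^\infty(A)=\bigcap_{n\ge0}\mathcal D(A^n)$. $A$ generates Stieltjes moment sequences if $\mathcal D^\infty(A)$ is dense in $\mathcal H$ and $\{\|A^nf\|^2\}_{n=0}^\infty$ is a Stieltjes moment sequence for every $f\in\mathcal D^\infty(A)$. $A$ is hyponormal if it is densely defined, $\mathcal D(A)\subseteq\mathcal D(A^* )$ and $\|A^*f\|\le\|Af\|$ for all $f\in\mathcal D(A)$. *)

(* Defs.v *)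
From HB Require Import structures.
From mathcomp Require Import all_boot all_order all_algebra.
From mathcomp Require Import complex.
From mathcomp Require Import all_classical all_reals all_analysis.
From mathcomp Require Import measurable_realfun.

Set Implicit Arguments.
Unset Strict Implicit.
Unset Printing Implicit Defensive.

Import Order.TTheory GRing.Theory Num.Theory.
Import numFieldNormedType.Exports.

Local Open Scope classical_set_scope.
Local Open Scope ring_scope.
Local Open Scope complex_scope.

Notation cabs := ComplexField.Normc.normc.

Section moments.
Context {R : realType}.

Notation borel_measure := {measure set (measurableTypeR R) -> \bar R}.
Implicit Types (nu rho : borel_measure) (gamma : nat -> R) (z : R[i]).

Definition finite_moments nu :=
  forall n : nat, (\int[nu]_t (`|t : R| ^+ n)%:E < +oo)%E.

Definition closed_support nu : set R :=
  ~` \bigcup_(U in [set U : set R | open U /\ nu U = 0%E]) U.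

Definition finite_moments_pos nu :=
  finite_moments nu /\ closed_support nu `<=` [set t : R | 0 <= t].

Definition has_moments nu gamma :=
  forall n : nat, (gamma n)%:E = (\int[nu]_t ((t : R) ^+ n)%:E)%E.

Definition H_representing gamma nu := finite_moments nu /\ has_moments nu gamma.

Definition S_representing gamma nu :=
  finite_moments_pos nu /\ has_moments nu gamma.

Definition Hamburger gamma := exists nu, H_representing gamma nu.

Definition Stieltjes gamma := exists nu, S_representing gamma nu.

(* Elements of [borel_measure] are total functions on [set R], so equality of
   the underlying measures means agreement on the Borel sets. *)
Definition H_determinate gamma :=
  Hamburger gamma /\
  forall nu1 nu2, H_representing gamma nu1 -> H_representing gamma nu2 ->
    forall A : set (measurableTypeR R), measurable A -> nu1 A = nu2 A.

Definition moment_seq nu : nat -> R :=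
  fun n => fine (\int[nu]_t ((t : R) ^+ n)%:E)%E.

Definition H_determinate_measure nu :=
  finite_moments nu /\ H_determinate (moment_seq nu).

(* the measure |t - z|^(2k) d rho(t) *)
Definition weighted rho z (k : nat) (A : set (measurableTypeR R)) : \bar R :=
  (\int[rho]_(t in A) (cabs ((t : R)%:C - z) ^+ (2 * k))%:E)%E.

Section weighted_measure.
Variables (rho : borel_measure) (z : R[i]) (k : nat).

Let weight (t : measurableTypeR R) : \bar R :=
  (cabs ((t : R)%:C - z) ^+ (2 * k))%:E.

Let weight_ge0 t : (0 <= weight t)%E.
Proof.
rewrite /weight lee_fin exprn_ge0//.
by case: ((t : R)%:C - z) => a b; exact: sqrtr_ge0.
Qed.

Let measurable_weight : measurable_fun setT weight.
Proof.
apply/measurable_EFinP; apply: measurable_funX.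
case: z => a b /=.
have -> : (fun t : R => Num.sqrt ((t - a) ^+ 2 + (0 - b) ^+ 2)) =
          Num.sqrt \o (fun t : R => (t - a) ^+ 2 + (0 - b) ^+ 2) by [].
apply: continuous_measurable_fun => t.
apply: continuous_comp; last exact: sqrt_continuous.
apply: cvgD; last exact: cvg_cst.
apply: (@continuous_comp _ _ _ (fun t : R => t - a) (fun t => t ^+ 2)).
  by apply: cvgB; [exact: cvg_id|exact: cvg_cst].
exact: exprn_continuous.
Qed.

Let weighted0 : weighted rho z k set0 = 0%E.
Proof. by rewrite /weighted integral_set0. Qed.

Let weighted_ge0 A : (0 <= weighted rho z k A)%E.
Proof. by apply: integral_ge0 => t _; exact: weight_ge0. Qed.

Let weighted_sigma_additive : semi_sigma_additive (weighted rho z k).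
Proof.
exact: (semi_sigma_additive_nng_induced measurable_weight weight_ge0).
Qed.

HB.instance Definition _ := isMeasure.Build _ _ _ (weighted rho z k)
  weighted0 weighted_ge0 weighted_sigma_additive.

End weighted_measure.

(* supremum in {0, 1, 2, ...} \cup {+oo}, embedded in the extended reals *)
Definition measure_index z rho : \bar R :=
  ereal_sup [set (k%:R)%:E | k in
    [set k : nat | H_determinate_measure (weighted rho z k)]].

(* For an H-determinate [gamma] the representing measure, hence [d], is unique. *)
Definition has_index gamma z (d : \bar R) :=
  exists2 rho, H_representing gamma rho & measure_index z rho = d.

Definition infinite_index gamma := exists z, has_index gamma z +oo%E.

End moments.

Section discrete_L2.
Context {R : realType} {d} {X : measurableType d}.
Variable mu : {measure set X -> \bar R}.

Definition discrete_measure :=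
  [/\ forall A : set X, measurable A,
      sigma_finite setT mu &
      forall x : X, (0 < mu [set x])%E].

(* When [mu] is discrete, every function is measurable and the only null set is
   empty, so L^2(mu) is literally a set of functions and almost-everywhere
   equality is equality. The definitions below are meant for that case. *)
Definition L2 : set (X -> R[i]) :=
  [set f | (\int[mu]_x (cabs (f x) ^+ 2)%:E < +oo)%E].

Definition L2norm (f : X -> R[i]) : R :=
  Num.sqrt (fine (\int[mu]_x (cabs (f x) ^+ 2)%:E)%E).

Definition L2inner (f g : X -> R[i]) : R[i] :=
  (\int[mu]_x complex.Re (f x * (g x)^*))%R +i*
  (\int[mu]_x complex.Im (f x * (g x)^*))%R.

(* A partial map of L^2(mu); the values of [app] outside [dom] are irrelevant. *)
Record operator := Operator {
  dom : set (X -> R[i]);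
  app :> (X -> R[i]) -> (X -> R[i])
}.

Implicit Types A : operator.

Definition injective_op A :=
  forall f g, dom A f -> dom A g -> A f = A g -> f = g.

Definition L2dense (D : set (X -> R[i])) :=
  forall f, L2 f -> forall e : R, 0 < e ->
    exists2 g, D g & L2norm (fun x => f x - g x) < e.

Fixpoint dom_pow A (n : nat) : set (X -> R[i]) :=
  if n is m.+1 then [set f | dom A f /\ dom_pow A m (A f)] else L2.

Definition dom_infty A : set (X -> R[i]) := \bigcap_n dom_pow A n.

Definition generates_Stieltjes A :=
  L2dense (dom_infty A) /\
  forall f, dom_infty A f -> Stieltjes (fun n => L2norm (iter n A f) ^+ 2).

Definition is_adjoint A (g h : X -> R[i]) :=
  L2 h /\ forall f, dom A f -> L2inner (A f) g = L2inner f h.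

(* If [A] is densely defined, the [h] selected by [xget] is the only one. *)
Definition adjoint A : operator := {|
  dom := [set g | L2 g /\ exists h, is_adjoint A g h];
  app := fun g => xget (fun=> 0) (is_adjoint A g)
|}.

Definition hyponormal A :=
  [/\ L2dense (dom A),
      dom A `<=` dom (adjoint A) &
      forall f, dom A f -> L2norm (adjoint A f) <= L2norm (A f)].

Definition composition_op (phi : X -> X) : operator := {|
  dom := [set f | L2 f /\ L2 (f \o phi)];
  app := fun f => f \o phi
|}.

Definition h_ (phi : X -> X) (n : nat) (x : X) : \bar R :=
  (mu (iter n phi @^-1` [set x]) / mu [set x])%E.

End discrete_L2.

(* The branch indices are shifted to start at 0: [Xarm i j] is x_(i+1,j+1). *)
Variant vertex := X0 | Xarm (i j : nat).

Definition vertex_code (v : vertex) : option (nat * nat) :=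
  if v is Xarm i j then Some (i, j) else None.

Definition vertex_decode (c : option (nat * nat)) : vertex :=
  if c is Some (i, j) then Xarm i j else X0.

Lemma vertex_codeK : cancel vertex_code vertex_decode.
Proof. by case. Qed.

HB.instance Definition _ := Countable.copy vertex (can_type vertex_codeK).
HB.instance Definition _ := isPointed.Build vertex X0.
HB.instance Definition _ := @isMeasurable.Build default_measure_display
  vertex discrete_measurable discrete_measurable0
  discrete_measurableC discrete_measurableU.

Definition phi_infty0 (v : vertex) : vertex :=
  match v with
  | X0 => X0
  | Xarm _ 0 => X0
  | Xarm i j.+1 => Xarm i j
  end.

(* Main.v *)
Require Import Defs.
From HB Require Import structures.
From mathcomp Require Import all_boot all_order all_algebra.
From mathcomp Require Import complex.
From mathcomp Require Import all_classical all_reals all_analysis.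
From mathcomp Require Import measurable_realfun.
From mathcomp Require Import ring lra.

Set Implicit Arguments.
Unset Strict Implicit.
Unset Printing Implicit Defensive.

Import Order.TTheory GRing.Theory Num.Theory.
Import numFieldNormedType.Exports.

Local Open Scope classical_set_scope.
Local Open Scope ring_scope.

(** The measure gives [X0] the mass 1 and the [j]-th vertex of the [i]-th arm the
    mass [a_i * s_i ^ j]. Along an arm [h_] is then the moment sequence
    [s_i ^ n] of a point mass, for which everything is immediate. At [X0] it is
    [gamma_n = 1 + sum_(j < n) tau_j], where [tau_j = sum_i a_i * s_i ^ j] are the
    moments of [tau = sum_i a_i * delta_(s_i)]. So if [gamma] is the moment
    sequence of a probability [nu] on the half line, the only constraint is that
    [tau] and [(t - 1) * nu] have the same moments. The squared norms of the
    iterates of the operator at [f] are the moments of the corresponding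
    superposition of [nu] and of the point masses, hence a Stieltjes moment
    sequence. If [tau] were equal to [(t - 1) * nu], the operator would be
    hyponormal; the point is to take two different measures with the same moments.

    Both come from one explicit family, the Al-Salam-Carlitz II weights for
    [q = 1 / r] up to a dilation: the atoms are [t_k = a * r ^ k] and the weights
    solve the Pearson equation
    [w_(k+1) * (t_(k+1) - a) * (t_(k+1) - b) = a * b * r * w_k]. Summing by parts,
    [sum w * (t - a) * (t - b) * f(t) = a * b * r * sum w * f(r * t)] for all [f],
    and the choices [f = t ^ n] and [f = 1 / t] determine the normalized moments
    by a recurrence ([pearson_moments_wmom]) that is symmetric in [a] and [b],
    although the atoms [a * r ^ k] are not. Besides, multiplication by [t - b]
    turns the parameters [(a, b)] into [(a, r * b)]. Take for [nu] the parameters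
    [(a, 1)]; then [(t - 1) * nu] has the parameters [(a, r)], and [tau] is chosen
    with the parameters [(r, a)], that is, with atoms at [r ^ (k + 1)]
    ([nmom_diff]). All weights are positive for [r < a < r ^ 2].

    Determinacy of [nu] ([H_determinate_nmom]): the Pearson equation shows that the
    polynomials [P_N = prod_(k < N) (1 - t / t_k)] satisfy
    [int P_N ^ 2 dnu <= (r / a) ^ N]. The same holds for any other measure with the
    moments of [nu]. As [P_N] is bounded away from 0 at each [t] other than the
    atoms, such a measure lives on the atoms, and the polynomials [P_N] with one
    factor removed isolate the mass of each atom ([H_determinate_criterion]).

    Index 0: since [t ^ 2 = (t - 1) * (t + 1) + 1], the measures [t ^ 2 * nu] and
    [(t + 1) * tau + nu] have the same moments, and only the second one charges [r]
    ([weighted_pmeasure_indeterminate]).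

    Failure of hyponormality: at the indicator of the first vertex of the first arm,
    the square of the norm of the adjoint is at least [a_0 ^ 2], and that of the
    operator is [a_0 * s_0]. The mean of [tau] bounds [a_0] from below
    ([first_nweight_ge]), and [a_0 > s_0] for [r = 8] and [a = 16]. *)

(** * Geometric estimates *)

Section geometric_estimates.
Context {R : realType}.
Implicit Types (u x : nat -> R) (c rho : R).

Lemma geometric_small c rho e : 0 < e -> 0 < rho < 1 ->
  exists n, c * rho ^+ n <= e.
Proof.
move=> e0 /andP[rho0 rho1].
have h : (fun n => c * rho ^+ n) @ \oo --> (0 : R).
  by apply: cvg_geometric; rewrite gtr0_norm.
have /cvgrPdist_le /(_ e e0) [N _ /(_ N (leqnn _)) /=] := h.
by rewrite sub0r normrN => hN; exists N; rewrite (le_trans _ hN)// ler_norm.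
Qed.

(** The first terms are removed one by one until the ratios are at most 1/2; from
    then on [2 * u 0 - 2 * u N] bounds the partial sums. *)
Lemma nneseries_ratio_lty c rho u : 0 <= c -> 0 < rho < 1 ->
  (forall k, 0 <= u k) -> (forall k, u k.+1 <= c * rho ^+ k * u k) ->
  (\sum_(k <oo) (u k)%:E < +oo)%E.
Proof.
move=> c0 rho01 u0 uS; have /andP[rho0 rho1] := rho01.
have [n] := @geometric_small c rho 2^-1 (ltac:(lra)) rho01.
elim: n c u c0 u0 uS => [|n IH] c u c0 u0 uS cn.
- have u2 k : 2 * u k.+1 <= u k.
    have /(le_trans (uS k)) : c * rho ^+ k * u k <= 2^-1 * u k.
      apply: ler_wpM2r => //; move: cn; rewrite expr0 mulr1; apply: le_trans.
      by rewrite ler_piMr// exprn_ile1// ltW.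
    by lra.
  have part N : \sum_(0 <= k < N) u k <= 2 * u 0%N - 2 * u N.
    elim: N => [|N IHN]; first by rewrite big_geq// subrr.
    rewrite big_nat_recr//=; have := u2 N; lra.
  apply: (@le_lt_trans _ _ (2 * u 0%N)%:E); last exact: ltry.
  apply: lime_le; first by apply: is_cvg_nneseries => i _ _; rewrite lee_fin.
  apply: nearW => N; rewrite sumEFin lee_fin (le_trans (part N))//.
  by rewrite gerBl mulr_ge0.
- rewrite nneseries_recl//.
  apply: lte_add_pinfty; first exact: ltry.
  rewrite -(@nneseries_addn _ (fun k => (u k)%:E))//.
  apply: (IH (c * rho)) => //; first by rewrite mulr_ge0// ltW.
  + by move=> k; rewrite !addn1 -(mulrA c) -exprS.
  + by rewrite -mulrA -exprS.
  + by move=> k _; rewrite lee_fin.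
Qed.

Lemma prod_1subr_ge_sum u N : (forall k, 0 <= u k <= 1) ->
  1 - \sum_(k < N) u k <= \prod_(k < N) (1 - u k).
Proof.
move=> u01; elim: N => [|N IH]; first by rewrite !big_ord0 subr0.
rewrite !big_ord_recr/=.
have p1 : \prod_(i < N) (1 - u i) <= 1.
  by apply: prodr_ile1 => i _; have := u01 i; lra.
have p0 : 0 <= \prod_(i < N) (1 - u i).
  by apply: prodr_ge0 => i _; have := u01 i; lra.
move: IH p1 p0 (u01 N); set p := \prod_(i < N) _; set s := \sum_(i < N) _.
nra.
Qed.

(** An infinite product of nonzero factors that tend to 1 geometrically fast has a
    nonzero limit: remove factors one by one until the sum of the remaining [x k]
    is at most 1/2. *)
Lemma prod_1subr_bounded_away c rho x : 0 <= c -> 0 < rho < 1 ->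
  (forall k, x k != 1) -> (forall k, `|x k| <= c * rho ^+ k) ->
  exists2 e, 0 < e & forall N, e <= `|\prod_(k < N) (1 - x k)|.
Proof.
move=> c0 rho01 x1 xc; have /andP[rho0 rho1] := rho01.
have [n] := @geometric_small c rho ((1 - rho) / 2) (ltac:(lra)) rho01.
elim: n c x c0 x1 xc => [|n IH] c x c0 x1 xc cn.
- exists 2^-1; first by lra.
  move=> N.
  have sumx M : \sum_(k < M) `|x k| <= 2^-1 * (1 - rho ^+ M).
    elim: M => [|M IHM]; first by rewrite big_ord0 expr0 subrr mulr0.
    rewrite big_ord_recr/= exprS; move: (xc M) cn IHM; rewrite expr0 mulr1.
    have : 0 <= rho ^+ M by rewrite exprn_ge0// ltW.
    move: (rho ^+ M) => p p0 xM cn IHM.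
    have : c * p <= (1 - rho) / 2 * p by apply: ler_wpM2r.
    by move: IHM xM; lra.
  have x01 k : 0 <= `|x k| <= 1.
    rewrite normr_ge0/= (le_trans (xc k))// (@le_trans _ _ c)//.
      by rewrite ler_piMr// exprn_ile1// ltW.
    by move: cn; rewrite expr0 mulr1; lra.
  have := prod_1subr_ge_sum N x01; have := sumx N.
  have : 0 <= rho ^+ N by rewrite exprn_ge0// ltW.
  have : \prod_(k < N) (1 - `|x k|) <= `|\prod_(k < N) (1 - x k)|.
    rewrite normr_prod; apply: ler_prod => k _; have := x01 k.
    move=> /andP[_ xk1]; rewrite subr_ge0 xk1/=.
    by have := lerB_dist 1 (x k); rewrite normr1.
  by lra.
- have [||||e e0 eN] := IH (c * rho) (fun k => x k.+1).
  + by rewrite mulr_ge0// ltW.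
  + by move=> k; exact: x1.
  + by move=> k; rewrite -mulrA -exprS; exact: xc.
  + by rewrite -mulrA -exprS.
  exists (Num.min 1 (`|1 - x 0%N| * e)).
    by rewrite lt_min ltr01 mulr_gt0// normr_gt0 subr_eq0 eq_sym x1.
  case=> [|N]; first by rewrite big_ord0 normr1 ge_min lexx.
  by rewrite big_ord_recl normrM ge_min ler_wpM2l ?orbT.
Qed.

End geometric_estimates.

(** * The Pearson weights and their sums *)

Section pearson_weights.
Context {R : realType}.
Variables (r a b : R).

Definition node (k : nat) : R := a * r ^+ k.

(** These are the masses of the Al-Salam-Carlitz II polynomials for [q = 1 / r],
    dilated so that the first atom is [a], with the first mass equal to 1. *)
Fixpoint weight (k : nat) : R :=
  if k is j.+1 then a * b * r / ((node k - a) * (node k - b)) * weight j else 1.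

Hypotheses (r1 : 1 < r) (a0 : 0 < a) (b0 : 0 < b) (bar : b < a * r).

Local Ltac slra := move: r1 a0 b0 bar; lra.

Let r0 : 0 < r. Proof. exact: lt_trans r1. Qed.

Lemma node0 : node 0 = a. Proof. by rewrite /node mulr1. Qed.

Lemma nodeS k : node k.+1 = r * node k.
Proof. by rewrite /node exprS mulrCA. Qed.

Lemma node_gt0 k : 0 < node k.
Proof. by rewrite mulr_gt0// exprn_gt0. Qed.

Lemma node_ge0 k : 0 <= node k. Proof. exact/ltW/node_gt0. Qed.

Lemma le_node k : a <= node k.
Proof. by rewrite ler_pMr// exprn_ege1// ltW. Qed.

Lemma leS_node k : a * r <= node k.+1.
Proof. by rewrite /node ler_pM2l// exprS ler_peMr ?exprn_ege1//; move: r1; lra. Qed.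

Lemma nodeS_suba_gt0 k : 0 < node k.+1 - a.
Proof.
have := leS_node k; have : a < a * r by rewrite ltr_pMr.
by lra.
Qed.

Lemma nodeS_subb_gt0 k : 0 < node k.+1 - b.
Proof. have := leS_node k; slra. Qed.

Lemma nodeS_suba_ge k : a * (r - 1) * r ^+ k <= node k.+1 - a.
Proof.
rewrite /node exprS; have : 1 <= r ^+ k by rewrite exprn_ege1// ltW.
by move: (r ^+ k) => p p1; move: r1 a0; nra.
Qed.

Lemma nodeS_ab_gt0 k : 0 < (node k.+1 - a) * (node k.+1 - b).
Proof. exact: mulr_gt0 (nodeS_suba_gt0 k) (nodeS_subb_gt0 k). Qed.

Lemma weight_gt0 k : 0 < weight k.
Proof.
elim: k => //= k IH.
rewrite mulr_gt0// divr_gt0 ?mulr_gt0 ?nodeS_suba_gt0 ?nodeS_subb_gt0//; slra.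
Qed.

Lemma weight_pearson k :
  weight k.+1 * ((node k.+1 - a) * (node k.+1 - b)) = a * b * r * weight k.
Proof.
rewrite /=; have := nodeS_suba_gt0 k; have := nodeS_subb_gt0 k => h1 h2.
by field; apply/andP; split; rewrite gt_eqF.
Qed.

Definition wsum (f : R -> R) : \bar R := \sum_(k <oo) (weight k * f (node k))%:E.

Lemma eq_wsum f g : (forall k, f (node k) = g (node k)) -> wsum f = wsum g.
Proof. by move=> fg; apply: eq_eseriesr => k _; rewrite fg. Qed.

Lemma wsum_ge0 f : (forall k, 0 <= f (node k)) -> (0 <= wsum f)%E.
Proof.
move=> f0; apply: nneseries_ge0 => k _ _.
by rewrite lee_fin mulr_ge0// ltW// weight_gt0.
Qed.

Lemma wsumD f g : (forall k, 0 <= f (node k)) -> (forall k, 0 <= g (node k)) ->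
  wsum (fun t => f t + g t)%R = (wsum f + wsum g)%E.
Proof.
move=> f0 g0; rewrite -nneseriesD; last 2 first.
- by move=> k _ _; rewrite lee_fin mulr_ge0// ltW// weight_gt0.
- by move=> k _ _; rewrite lee_fin mulr_ge0// ltW// weight_gt0.
by apply: eq_eseriesr => k _; rewrite mulrDr EFinD.
Qed.

Lemma wsumZ c f : (forall k, 0 <= f (node k)) ->
  wsum (fun t => c * f t)%R = (c%:E * wsum f)%E.
Proof.
move=> f0; rewrite -nneseriesZl; last first.
  by move=> k _; rewrite lee_fin mulr_ge0// ltW// weight_gt0.
by apply: eq_eseriesr => k _; rewrite mulrCA EFinM.
Qed.

Lemma le_wsum f g : (forall k, 0 <= f (node k) <= g (node k)) ->
  (wsum f <= wsum g)%E.
Proof.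
move=> fg; apply: lee_nneseries => k.
  by move=> _ _; rewrite lee_fin mulr_ge0// ?(ltW (weight_gt0 _))//; case/andP: (fg k).
by rewrite lee_fin ler_wpM2l// ?(ltW (weight_gt0 _))//; case/andP: (fg k).
Qed.

Lemma wsum_shift f : f a = 0 -> (forall k, 0 <= f (node k.+1)) ->
  wsum f = (\sum_(k <oo) (weight k.+1 * f (node k.+1))%:E)%E.
Proof.
move=> fa f0; have fk k : 0 <= f (node k).
  by case: k => //; rewrite node0 fa.
have wf0 k : (0 <= (weight k * f (node k))%:E)%E.
  by rewrite lee_fin mulr_ge0// ltW// weight_gt0.
rewrite /wsum nneseries_recl// node0 fa mulr0 add0e.
rewrite -(@nneseries_addn _ (fun k => (weight k * f (node k))%:E))//.
by apply: eq_eseriesr => k _; rewrite addn1.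
Qed.

(** Summation by parts: [(t - a) * (t - b)] vanishes at the first node, and the
    Pearson equation moves the other terms to the preceding node. The terms are
    arranged so that both sides are sums of nonnegative numbers. *)
Lemma wsum_pearson f : (forall k, 0 <= f (node k)) ->
  wsum (fun t => (t ^+ 2 + a * b) * f t)%R =
  (wsum (fun t => (a + b) * (t * f t))%R + (a * b * r)%:E * wsum (fun t => f (r * t))%R)%E.
Proof.
move=> f0.
transitivity (wsum (fun t => (a + b) * (t * f t))%R +
              wsum (fun t => (t - a) * (t - b) * f t)%R)%E.
  rewrite -wsumD.
  - by apply: eq_wsum => k; ring.
  - by move=> k; rewrite mulr_ge0 ?(mulr_ge0 (node_ge0 k))//; slra.
  - case=> [|k]; first by rewrite node0 subrr !mul0r.
    by rewrite (mulr_ge0 (ltW (nodeS_ab_gt0 k))).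
congr (_ + _)%E; rewrite wsum_shift.
- rewrite -wsumZ; last by move=> k; rewrite -nodeS.
  apply: eq_eseriesr => k _.
  by rewrite mulrA weight_pearson nodeS; congr EFin; ring.
- by rewrite subrr !mul0r.
- by move=> k; rewrite (mulr_ge0 (ltW (nodeS_ab_gt0 k))).
Qed.

Lemma wsum1_lty : (wsum (fun=> 1)%R < +oo)%E.
Proof.
have e0 : 0 < (r - 1) * (a * r - b) by rewrite mulr_gt0//; slra.
pose c := b * r / ((r - 1) * (a * r - b)).
apply: (@nneseries_ratio_lty _ c r^-1).
- by rewrite /c divr_ge0 ?mulr_ge0//; slra.
- by rewrite invr_gt0 invf_lt1; slra.
- by move=> k; rewrite mulr1 ltW// weight_gt0.
move=> k; rewrite !mulr1 [leLHS]/=; apply: ler_wpM2r; first exact/ltW/weight_gt0.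
rewrite ler_pdivrMr; last by rewrite mulr_gt0 ?nodeS_suba_gt0 ?nodeS_subb_gt0.
have h1 := nodeS_suba_ge k.
have h2 : a * r - b <= node k.+1 - b by have := leS_node k; slra.
have rk : 0 < r ^+ k by rewrite exprn_gt0//; slra.
have -> : a * b * r =
    c / r ^+ k * ((a * (r - 1) * r ^+ k) * (a * r - b)).
  rewrite /c; field.
  by rewrite !gt_eqF//; slra.
rewrite exprVn; apply: ler_wpM2l.
  by rewrite !(mulr_ge0, invr_ge0)//; slra.
by apply: ler_pM => //; rewrite ?mulr_ge0//; slra.
Qed.

Definition wmom (n : nat) : R := fine (wsum (fun t => t ^+ n)%R).

Lemma nodeX_ge0 n k : 0 <= node k ^+ n.
Proof. by rewrite exprn_ge0// ltW// node_gt0. Qed.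

(** [wsum_pearson] bounds the moment of order [n + 2] by those of orders [n] and
    [n + 1], and for [f = 1 / t] that of order 1 by that of order 0. *)
Lemma wsumX_lty n : (wsum (fun t => t ^+ n)%R < +oo)%E.
Proof.
suff : (wsum (fun t => t ^+ n)%R < +oo)%E /\ (wsum (fun t => t ^+ n.+1)%R < +oo)%E.
  by case.
elim: n => [|n [IH1 IH2]]; split => //; first exact: wsum1_lty.
- apply: (@le_lt_trans _ _ (wsum (fun t => (t ^+ 2 + a * b) * t^-1)%R)).
    apply: le_wsum => k; rewrite nodeX_ge0/=.
    have t0 := node_gt0 k; rewrite mulrDl expr1 expr2 mulfK ?gt_eqF// lerDl.
    by rewrite mulr_ge0 ?invr_ge0 ?node_ge0 ?mulr_ge0//; slra.
  rewrite wsum_pearson; last by move=> k; rewrite invr_ge0 ltW// node_gt0.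
  apply: lte_add_pinfty.
    rewrite (@eq_wsum _ (fun t => (a + b) * 1)).
      by rewrite wsumZ// ltey_eq; apply/orP; left; rewrite fin_numM// ge0_fin_numE ?wsum1_lty// wsum_ge0.
    by move=> k; rewrite divff// gt_eqF// node_gt0.
  have : (wsum (fun t => (r * t)^-1)%R <= (a^-1)%:E * wsum (fun=> 1)%R)%E.
    rewrite -wsumZ//; apply: le_wsum => k; rewrite -nodeS mulr1.
    by rewrite invr_ge0 ltW ?node_gt0//= lef_pV2 ?posrE ?node_gt0 ?le_node.
  move=> h; rewrite lte_mul_pinfty//.
    by rewrite lee_fin !mulr_ge0//; slra.
  apply: le_lt_trans h _; rewrite lte_mul_pinfty//; last exact: wsum1_lty.
  by rewrite lee_fin invr_ge0 ltW.
- apply: (@le_lt_trans _ _ (wsum (fun t => (t ^+ 2 + a * b) * t ^+ n)%R)).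
    apply: le_wsum => k; rewrite nodeX_ge0/=.
    by rewrite mulrDl -exprD lerDl mulr_ge0 ?nodeX_ge0 ?mulr_ge0//; slra.
  rewrite wsum_pearson; last by move=> k; exact: nodeX_ge0.
  apply: lte_add_pinfty.
    rewrite wsumZ; last by move=> k; rewrite -exprS nodeX_ge0.
    rewrite lte_mul_pinfty//; first by rewrite lee_fin; slra.
    by rewrite (@eq_wsum _ (fun t => t ^+ n.+1))// => k; rewrite exprS.
  rewrite (@eq_wsum _ (fun t => r ^+ n * t ^+ n)); last first.
    by move=> k; rewrite exprMn.
  rewrite wsumZ; last by move=> k; rewrite nodeX_ge0.
  rewrite lte_mul_pinfty//; first by rewrite lee_fin !mulr_ge0//; slra.
  by rewrite lte_mul_pinfty// lee_fin exprn_ge0//; slra.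
Qed.

Lemma wmomE n : wsum (fun t => t ^+ n)%R = (wmom n)%:E.
Proof.
rewrite fineK// ge0_fin_numE ?wsumX_lty// wsum_ge0// => k; exact: nodeX_ge0.
Qed.

End pearson_weights.

(** * The recurrence for the moments *)

Section moment_recurrence.
Context {R : realType}.
Implicit Types (m : nat -> R) (r a b c : R).

(** [wsum_pearson] for [f = 1 / t] and [f = t ^ n]; note the symmetry in [a] and
    [b]. *)
Definition pearson_moments r a b m := m 1%N = (a + b) * m 0%N /\
  forall n, m n.+2 = (a + b) * m n.+1 + a * b * (r ^+ n.+1 - 1) * m n.

Lemma pearson_momentsZ c r a b m : pearson_moments r a b m ->
  pearson_moments r a b (fun n => c * m n).
Proof. by case=> h1 h2; split=> [|n]; rewrite ?h1 ?h2; ring. Qed.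

Lemma pearson_moments_unique r a b m1 m2 : pearson_moments r a b m1 ->
  pearson_moments r a b m2 -> m1 0%N = m2 0%N -> m1 =1 m2.
Proof.
move=> [h11 h12] [h21 h22] h0 n.
suff : m1 n = m2 n /\ m1 n.+1 = m2 n.+1 by case.
elim: n => [|n [IH1 IH2]]; first by rewrite h11 h21 h0.
by rewrite h12 h22 IH1 IH2.
Qed.

Lemma pearson_moments_wmom r a b : 1 < r -> 0 < a -> 0 < b -> b < a * r ->
  pearson_moments r a b (wmom r a b).
Proof.
move=> r1 a0 b0 bar; have r0 : 0 < r by lra.
have E n := wmomE r1 a0 b0 bar n.
have X n k := nodeX_ge0 r1 a0 n k.
have t0 k := node_gt0 r1 a0 k.
have V k : 0 <= (node r a k)^-1 by rewrite invr_ge0 ltW.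
split=> [|n].
- have := @wsum_pearson _ _ _ _ r1 a0 b0 bar (fun t => t^-1) V.
  have [v vE] : exists v, wsum r a b (fun t => t^-1)%R = v%:E.
    exists (fine (wsum r a b (fun t => t^-1)%R)); rewrite fineK// ge0_fin_numE.
      apply: (@le_lt_trans _ _ (wsum r a b (fun t => a^-1 * t ^+ 0)%R)).
        apply: le_wsum => // k; rewrite V/= mulr1 lef_pV2 ?posrE//.
        exact: le_node.
      by rewrite wsumZ// E -EFinM ltry.
    exact: wsum_ge0.
  rewrite (@eq_wsum _ _ _ _ (fun t => (t ^+ 2 + a * b) * t^-1)
    (fun t => t ^+ 1 + (a * b) * t^-1)); last first.
    by move=> k; rewrite mulrDl expr1 expr2 mulfK// gt_eqF.
  rewrite (@eq_wsum _ _ _ _ (fun t => (a + b) * (t * t^-1))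
    (fun t => (a + b) * t ^+ 0)); last first.
    by move=> k; rewrite divff// gt_eqF.
  rewrite (@eq_wsum _ _ _ _ (fun t => (r * t)^-1)
    (fun t => r^-1 * t^-1)); last by move=> k; rewrite invfM.
  rewrite wsumD//; last by move=> k; rewrite mulr_ge0 ?V// mulr_ge0// ltW.
  rewrite !wsumZ// vE !E -!EFinM -!EFinD => -[].
  have -> : a * b * r * (r^-1 * v) = a * b * v by field; rewrite gt_eqF.
  by move/addIr.
- have := @wsum_pearson _ _ _ _ r1 a0 b0 bar (fun t => t ^+ n) (X n).
  rewrite (@eq_wsum _ _ _ _ (fun t => (t ^+ 2 + a * b) * t ^+ n)
    (fun t => t ^+ n.+2 + (a * b) * t ^+ n)); last first.
    by move=> k; rewrite mulrDl -exprD.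
  rewrite (@eq_wsum _ _ _ _ (fun t => (a + b) * (t * t ^+ n))
    (fun t => (a + b) * t ^+ n.+1)); last by move=> k; rewrite exprS.
  rewrite (@eq_wsum _ _ _ _ (fun t => (r * t) ^+ n)
    (fun t => r ^+ n * t ^+ n)); last by move=> k; rewrite exprMn.
  rewrite wsumD//; last by move=> k; rewrite mulr_ge0 ?X// mulr_ge0// ltW.
  rewrite !wsumZ// !E -!EFinM -!EFinD => -[] h.
  by rewrite exprS; lra.
Qed.

Lemma wmom0_gt0 r a b : 1 < r -> 0 < a -> 0 < b -> b < a * r -> 0 < wmom r a b 0.
Proof.
move=> r1 a0 b0 bar; rewrite -lte_fin -wmomE//.
have wk k : 0 < weight r a b k by exact: weight_gt0.
apply: (@lt_le_trans _ _ (weight r a b 0)%:E); first by rewrite lte_fin.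
rewrite /wsum nneseries_recl//; last first.
  by move=> k _; rewrite lee_fin expr0 mulr1 ltW.
rewrite expr0 mulr1 leeDl// nneseries_ge0// => k _ _.
by rewrite lee_fin expr0 mulr1 ltW.
Qed.

(** The moments of the weights rescaled to the total mass [c]. *)
Definition nmom c r a b n := c / wmom r a b 0 * wmom r a b n.

Lemma nmom0 c r a b : 1 < r -> 0 < a -> 0 < b -> b < a * r -> nmom c r a b 0 = c.
Proof. by move=> *; rewrite /nmom divfK// gt_eqF// wmom0_gt0. Qed.

Lemma pearson_moments_nmom c r a b : 1 < r -> 0 < a -> 0 < b -> b < a * r ->
  pearson_moments r a b (nmom c r a b).
Proof. by move=> *; apply/pearson_momentsZ/pearson_moments_wmom. Qed.

(** The differences are the moments of [t - 1] times the measure with parameters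
    [(a, 1)], so they satisfy the recurrence with parameters [(a, r)], which is
    also the one with parameters [(r, a)]; their first term is
    [(a + 1) - 1 = a]. *)
Lemma nmom_diff r a : 1 < r -> r < a -> a < r ^+ 2 -> forall n,
  nmom 1 r a 1 n.+1 - nmom 1 r a 1 n = nmom a r r a n.
Proof.
move=> r1 ra ar2.
have [g1 g2] : pearson_moments r a 1 (nmom 1 r a 1).
  by apply: pearson_moments_nmom; nra.
have g0 : nmom 1 r a 1 0 = 1 by apply: nmom0; nra.
move: (nmom 1 r a 1) g0 g1 g2 => g g0 g1 g2.
apply: (@pearson_moments_unique r r a); last first.
- by rewrite nmom0 ?g1 ?g0; try nra; rewrite -expr2.
- by apply: pearson_moments_nmom; try nra; rewrite -expr2.
have c1 n : g n.+2 - g n.+1 = a * (g n.+1 - g n) + a * r ^+ n.+1 * g n.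
  by rewrite g2; ring.
split=> [|n]; first by rewrite c1 g1 g0; ring.
have e : g n.+2 = g n.+1 + (a * (g n.+1 - g n) + a * r ^+ n.+1 * g n).
  by rewrite -c1; ring.
by rewrite c1 (exprS _ n.+1) e; ring.
Qed.

End moment_recurrence.

(** * Atomic measures *)

Section atoms.
Context d (T : measurableType d) {R : realType}.
Implicit Types (w : nat -> R) (x : nat -> T).

(** The weights are used for [0 <= w] only; the absolute value spares a bundled
    proof of nonnegativity. *)
Definition atoms w x : {measure set T -> \bar R} :=
  mseries (fun k => mscale (`|w k|%:nng) \d_(x k)) 0.

Lemma atomsE w x A : (forall k, 0 <= w k) ->
  (atoms w x A = \sum_(k <oo) (w k * (x k \in A)%:R)%:E)%E.
Proof.
move=> w0; rewrite /atoms/= /mseries; apply: eq_eseriesr => k _.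
by rewrite /= /mscale/= /dirac indicE ger0_norm// EFinM.
Qed.

Lemma integral_atoms w x (f : T -> \bar R) : (forall k, 0 <= w k) ->
  measurable_fun setT f -> (forall t, 0 <= f t)%E ->
  (\int[atoms w x]_t f t = \sum_(k <oo) ((w k)%:E * f (x k)))%E.
Proof.
move=> w0 mf f0; rewrite ge0_integral_measure_series//.
apply: eq_eseriesr => k _; rewrite ge0_integral_mscale//= ger0_norm//.
by rewrite integral_dirac// diracT mul1e.
Qed.

End atoms.

Section real_line.
Context {R : realType}.
Local Notation borel_measure := {measure set (measurableTypeR R) -> \bar R}.
Implicit Types (nu rho : borel_measure) (gamma : nat -> R).

Lemma measurable_exprn n : measurable_fun setT (fun t : measurableTypeR R => ((t : R) ^+ n)%:E).
Proof. by apply/measurable_EFinP; exact: measurable_funX. Qed.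

Lemma measurable_norm_exprn n :
  measurable_fun setT (fun t : measurableTypeR R => (`|t : R| ^+ n)%:E).
Proof.
by apply/measurable_EFinP; apply: measurable_funX; exact: normr_measurable.
Qed.

(** The moments of odd order are given by integrals of functions of both signs; for
    a measure that does not charge the negative reals it suffices to integrate
    nonnegative functions. *)
Lemma S_representing_nonneg gamma nu : nu [set t : R | t < 0] = 0%E ->
  (forall n, (\int[nu]_t (`|t : R| ^+ n)%:E = (gamma n)%:E)%E) ->
  S_representing gamma nu.
Proof.
move=> nu0 nun; split; first split.
- by move=> n; rewrite nun ltry.
- move=> t /= t_supp; rewrite leNgt; apply/negP => t0; apply: t_supp.
  by exists [set t : R | t < 0]; [split; [exact: open_lt|exact: nu0]|].
- move=> n; rewrite -nun; apply: ae_eq_integral => //.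
  + exact: measurable_norm_exprn.
  + exact: measurable_exprn.
  + exists [set t : R | t < 0]; split => //.
      by apply: open_measurable; exact: open_lt.
    move=> t /= h; rewrite ltNge; apply/negP => t0; apply: h => _.
    by rewrite ger0_norm.
Qed.

Definition atomic_moments (w : nat -> R) (x : nat -> R) gamma :=
  forall n, (\sum_(i <oo) (w i * x i ^+ n)%:E = (gamma n)%:E)%E.

Lemma atoms_neg (w : nat -> R) (x : nat -> measurableTypeR R) :
  (forall i, 0 <= w i) -> (forall i, 0 <= (x i : R)) ->
  atoms w x [set t : R | t < 0] = 0%E.
Proof.
move=> w0 x0; rewrite atomsE// eseries0// => i _ _.
by rewrite memNset ?mulr0//= => /(le_lt_trans (x0 i)); rewrite ltxx.
Qed.

Lemma integral_norm_atoms (w : nat -> R) (x : nat -> measurableTypeR R) n :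
  (forall i, 0 <= w i) -> (forall i, 0 <= (x i : R)) ->
  (\int[atoms w x]_t (`|t : R| ^+ n)%:E = \sum_(i <oo) (w i * (x i : R) ^+ n)%:E)%E.
Proof.
move=> w0 x0; rewrite integral_atoms//; last exact: measurable_norm_exprn.
by apply: eq_eseriesr => i _; rewrite ger0_norm.
Qed.

Lemma S_representing_atoms gamma (w : nat -> R) (x : nat -> measurableTypeR R) :
  (forall i, 0 <= w i) -> (forall i, 0 <= (x i : R)) ->
  atomic_moments w x gamma -> S_representing gamma (atoms w x).
Proof.
move=> w0 x0 mom; apply: S_representing_nonneg; first exact: atoms_neg.
by move=> n; rewrite integral_norm_atoms.
Qed.

Lemma S_representing_H gamma nu : S_representing gamma nu -> H_representing gamma nu.
Proof. by move=> [[]]. Qed.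

Lemma H_representing_integrableX gamma nu n : H_representing gamma nu ->
  nu.-integrable setT (fun t : measurableTypeR R => ((t : R) ^+ n)%:E).
Proof.
move=> [fin_nu _]; apply/integrableP; split; first exact: measurable_exprn.
by under eq_integral do rewrite /= normrX; exact: fin_nu.
Qed.

Lemma measurable_horner (p : {poly R}) :
  measurable_fun setT (fun t : measurableTypeR R => p.[t : R]%:E).
Proof.
apply/measurable_EFinP; apply: continuous_measurable_fun.
exact/continuous_horner.
Qed.

Lemma integral_horner gamma nu (p : {poly R}) : H_representing gamma nu ->
  (\int[nu]_t p.[t]%:E = (\sum_(i < size p) p`_i * gamma i)%:E)%E.
Proof.
move=> H; under eq_integral do rewrite horner_coef -sumEFin.
have I i : nu.-integrable setT (fun t : measurableTypeR R => (p`_i * (t : R) ^+ i)%:E).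
  under eq_fun do rewrite EFinM.
  by apply: integrableZl => //; exact: (H_representing_integrableX i H).
rewrite integral_sum//=.
rewrite -sumEFin; apply: eq_bigr => i _.
under eq_integral do rewrite EFinM.
rewrite integralZl//; last exact: (H_representing_integrableX i H).
by rewrite -(proj2 H) EFinM.
Qed.

End real_line.

(** * A criterion for determinacy *)

Section determinacy_criterion.
Context {R : realType}.
Local Notation borel_measure := {measure set (measurableTypeR R) -> \bar R}.
Implicit Types (nu rho : borel_measure) (gamma : nat -> R) (p : {poly R}).

Lemma measurable_sqr_horner p :
  measurable_fun setT (fun t : measurableTypeR R => (p.[t : R] ^+ 2)%:E).
Proof. by under eq_fun do rewrite -horner_exp; exact: measurable_horner. Qed.

Lemma eq_integral_sqr_horner gamma nu1 nu2 p :
  H_representing gamma nu1 -> H_representing gamma nu2 ->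
  (\int[nu1]_t (p.[t] ^+ 2)%:E = \int[nu2]_t (p.[t] ^+ 2)%:E)%E.
Proof.
move=> h1 h2; under eq_integral do rewrite -horner_exp.
under [RHS]eq_integral do rewrite -horner_exp.
by rewrite (integral_horner _ h1) (integral_horner _ h2).
Qed.

Lemma H_representing_fin gamma nu (A : set (measurableTypeR R)) :
  H_representing gamma nu -> measurable A -> (nu A < +oo)%E.
Proof.
move=> [fin_nu _] mA; apply: (@le_lt_trans _ _ (nu setT)).
  by rewrite le_measure// inE.
have := fin_nu 0%N; under eq_integral do rewrite expr0.
by rewrite integral_cst// mul1e.
Qed.

Lemma measurable_ge_sqr_horner p c :
  measurable ([set t | c <= p.[t] ^+ 2] : set (measurableTypeR R)).
Proof.
have := @emeasurable_fun_c_infty _ _ _ setT _ measurableT (measurable_sqr_horner p) c%:E.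
by rewrite setTI; under eq_set do rewrite lee_fin.
Qed.

(** The complement of [L] is covered by the sets on which all the [(P N) ^+ 2] are
    at least [1 / (m + 1)]; by the Markov inequality each of them is null. *)
Lemma null_of_small_integral nu (P : nat -> {poly R}) (L : set R) :
  (forall e, 0 < e -> exists N, (\int[nu]_t ((P N).[t] ^+ 2)%:E <= e%:E)%E) ->
  (forall t, ~ L t -> exists2 c, 0 < c & forall N, c <= (P N).[t] ^+ 2) ->
  countable L -> nu (~` L) = 0%E.
Proof.
move=> smallP awayP ctL.
pose E m : set (measurableTypeR R) := \bigcap_N [set t | m.+1%:R^-1 <= (P N).[t] ^+ 2].
have mE m : measurable (E m).
  by apply: bigcapT_measurable => N; exact: measurable_ge_sqr_horner.
have E0 m : nu (E m) = 0%E.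
  apply/eqP; rewrite eq_le measure_ge0 andbT; apply/lee_addgt0Pr => e e0.
  rewrite add0e; have m0 : 0 < m.+1%:R^-1 :> R by rewrite invr_gt0.
  have [N PN] := smallP (m.+1%:R^-1 * e) (mulr_gt0 m0 e0).
  rewrite -(@lee_pmul2l _ (m.+1%:R^-1)%:E)//.
  apply: le_trans PN; rewrite -integral_cst//.
  apply: (@le_trans _ _ (\int[nu]_(t in E m) ((P N).[t] ^+ 2)%:E)%E).
    apply: ge0_le_integral => //.
    - by move=> t _ /=; rewrite lee_fin ltW.
    - apply: measurable_funTS; exact: measurable_sqr_horner.
    - by move=> t /(_ N Logic.I).
  apply: ge0_subset_integral => //; first exact: measurable_sqr_horner.
  by move=> t _; rewrite lee_fin sqr_ge0.
have mL : measurable (~` L : set (measurableTypeR R)).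
  by apply: measurableC; apply: countable_measurable => // t; exact: measurable_set1.
apply: measure_negligible => //.
have : nu.-negligible (\bigcup_m E m).
  apply: negligible_bigcup => m; exact: (iffRL (negligibleP nu (mE m)) (E0 m)).
apply: negligibleS.
move=> t /awayP[c c0 cP]; exists (Num.truncn c^-1) => // N _ /=.
apply: le_trans (cP N); rewrite -[leRHS]invrK lef_pV2 ?posrE ?invr_gt0//.
exact/ltW/truncnS_gt.
Qed.

(** Compare the integrals of [(Q N) ^+ 2]: for [nu1] it is at least the
    contribution of [s]; for [nu2], which lives on [L], it is at most the
    contribution of [s] plus [C] times the small integral of [(P N) ^+ 2]. *)
Lemma point_mass_le gamma nu1 nu2 (P Q : nat -> {poly R}) (L : set R) (s c C : R) :
  H_representing gamma nu1 -> H_representing gamma nu2 -> nu2 (~` L) = 0%E ->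
  countable L ->
  (forall e, 0 < e -> exists N, (\int[nu2]_t ((P N).[t] ^+ 2)%:E <= e%:E)%E) ->
  0 < c -> 0 <= C -> (forall N, c <= (Q N).[s] ^+ 2) ->
  (forall N t, L t -> t != s -> (Q N).[t] ^+ 2 <= C * (P N).[t] ^+ 2) ->
  (nu1 [set s] <= nu2 [set s])%E.
Proof.
move=> h1 h2 nu2L ctL smallP c0 C0 Qs QP.
have ms : measurable ([set s] : set (measurableTypeR R)) by exact: measurable_set1.
have f1 : nu1 [set s] \is a fin_num by rewrite ge0_fin_numE// (H_representing_fin h1).
have f2 : nu2 [set s] \is a fin_num by rewrite ge0_fin_numE// (H_representing_fin h2).
rewrite -(fineK f1) -(fineK f2) lee_fin leNgt; apply/negP.
move: (fineK f1) (fineK f2); move: (fine _) (fine _) => x2 x1 e1 e2 x21.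
(* Small enough for [C * e < c * (x1 - x2)]. *)
pose e := (x1 - x2) * c / (2 * (C + 1)).
have e0 : 0 < e by rewrite divr_gt0 ?mulr_gt0//; lra.
have [N PN] := smallP e e0; set q := (Q N).[s] ^+ 2; have cq : c <= q := Qs N.
have : (q%:E * nu1 [set s] <= q%:E * nu2 [set s] + C%:E * e%:E)%E.
  apply: (@le_trans _ _ (\int[nu1]_t ((Q N).[t] ^+ 2)%:E)%E).
    have -> : (q%:E * nu1 [set s] = \int[nu1]_(t in [set s]) ((Q N).[t] ^+ 2)%:E)%E.
      rewrite -integral_cst//; apply: eq_integral => t.
      by rewrite inE => ->.
    apply: ge0_subset_integral => //; first exact: measurable_sqr_horner.
    by move=> t _; rewrite lee_fin sqr_ge0.
  rewrite (eq_integral_sqr_horner _ h1 h2).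
  pose g (t : measurableTypeR R) := (q%:E * (\1_[set s] t)%:E + C%:E * ((P N).[t] ^+ 2)%:E)%E.
  have mI : measurable_fun setT (fun t : measurableTypeR R => q%:E * (\1_[set s] t)%:E)%E.
    by apply: measurable_funeM; exact/measurable_EFinP.
  have mP : measurable_fun setT (fun t : measurableTypeR R => C%:E * ((P N).[t] ^+ 2)%:E)%E.
    by apply: measurable_funeM; exact: measurable_sqr_horner.
  have q0 : 0 <= q by exact: sqr_ge0.
  apply: (@le_trans _ _ (\int[nu2]_t g t)%E).
    apply: ae_ge0_le_integral => //.
    - by move=> t _; rewrite lee_fin sqr_ge0.
    - exact: measurable_sqr_horner.
    - by move=> t _; rewrite /g -!EFinM -EFinD lee_fin addr_ge0// mulr_ge0// sqr_ge0.
    - exact: emeasurable_funD.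
    - exists (~` L); split => //.
        apply: measurableC; apply: countable_measurable => // t; exact: measurable_set1.
      move=> t /= h Lt; apply: h => _; rewrite /g -!EFinM -EFinD lee_fin.
      rewrite indicE; have [->|ts] := eqVneq t s.
        by rewrite mem_set// mulr1 lerDl mulr_ge0// sqr_ge0.
      rewrite memNset ?mulr0 ?add0r//; first exact: QP.
      by move=> /= /eqP; exact/negP.
  rewrite /g ge0_integralD//; last 2 first.
  - by move=> t _; rewrite -EFinM lee_fin mulr_ge0.
  - by move=> t _; rewrite -EFinM lee_fin mulr_ge0// sqr_ge0.
  rewrite !ge0_integralZl//; last 3 first.
  - exact: measurable_sqr_horner.
  - by move=> t _; rewrite lee_fin sqr_ge0.
  - exact/measurable_EFinP.
  rewrite integral_indic// setIT leeD2l// lee_wpmul2l//.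
rewrite -e1 -e2 -!EFinM -EFinD lee_fin => h.
have : c * (x1 - x2) <= q * (x1 - x2) by rewrite ler_wpM2r//; lra.
have : C * e < c * (x1 - x2).
  have y0 : 0 < c * (x1 - x2) by rewrite mulr_gt0//; lra.
  rewrite /e (mulrC _ c) [ltLHS]mulrA ltr_pdivrMr ?mulr_gt0//; last lra.
  by move: (c * (x1 - x2)) y0 => y; nra.
by lra.
Qed.

Lemma eq_measure_on_countable nu1 nu2 (L : set R) : countable L ->
  nu1 (~` L) = 0%E -> nu2 (~` L) = 0%E ->
  (forall s, L s -> nu1 [set s] = nu2 [set s]) ->
  forall A : set (measurableTypeR R), measurable A -> nu1 A = nu2 A.
Proof.
move=> ctL n1 n2 e12 A mA.
have mL : measurable (L : set (measurableTypeR R)).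
  by apply: countable_measurable => // t; exact: measurable_set1.
have split nu : nu (~` L) = 0%E -> nu A = nu (A `&` L).
  move=> n; rewrite -[in LHS](setUIDK A L) measureU.
  - rewrite [X in (_ + X)%E](_ : _ = 0%E) ?adde0//.
    apply/measure_negligible; first exact: measurableD.
    by exists (~` L); split; [exact: measurableC|exact: n|move=> t []].
  - exact: measurableI.
  - exact: measurableD.
  - by rewrite setDE setIACA setICr setI0.
rewrite !split//.
have /countable_injP[f finj] := ctL.
pose F n : set (measurableTypeR R) := A `&` L `&` f @^-1` [set n].
have -> : A `&` L = \bigcup_n F n.
  apply/seteqP; split => [t ALt|t [n _ []]//]; by exists (f t).
have F1 n s : F n s -> F n = [set s].
  move=> [[As Ls] fs]; apply/seteqP; split => [t [[At Lt] ft]|t ->//] /=.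
  by apply: finj; rewrite ?inE// fs.
have mF n : measurable (F n).
  have [->|/set0P[s Fs]] := eqVneq (F n) set0; first exact: measurable0.
  by rewrite (F1 _ _ Fs); exact: measurable_set1.
have tF : trivIset setT F.
  by move=> i j _ _ [t [[_ /= <-] [_ /= <-]]].
rewrite !measure_semi_bigcup//; try exact: bigcup_measurable.
apply: eq_eseriesr => n _.
have [->|/set0P[s Fs]] := eqVneq (F n) set0; first by rewrite !measure0.
by rewrite (F1 _ _ Fs) e12//; case: Fs => -[].
Qed.

(** Two measures with the same moments give the same integrals to squares of
    polynomials. Hence both live on [L], and [point_mass_le] applies in both
    directions at each point of [L]. *)
Lemma H_determinate_criterion gamma rho (P : nat -> {poly R}) (L : set R) :
  H_representing gamma rho -> countable L ->
  (forall e, 0 < e -> exists N, (\int[rho]_t ((P N).[t] ^+ 2)%:E <= e%:E)%E) ->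
  (forall t, ~ L t -> exists2 c, 0 < c & forall N, c <= (P N).[t] ^+ 2) ->
  (forall s, L s -> exists (Q : nat -> {poly R}) (c C : R),
    [/\ 0 < c, 0 <= C, forall N, c <= (Q N).[s] ^+ 2 &
        forall N t, L t -> t != s -> (Q N).[t] ^+ 2 <= C * (P N).[t] ^+ 2]) ->
  H_determinate gamma.
Proof.
move=> hrho ctL smallP awayP onP; split; first by exists rho.
have small nu : H_representing gamma nu ->
    forall e, 0 < e -> exists N, (\int[nu]_t ((P N).[t] ^+ 2)%:E <= e%:E)%E.
  move=> h e /smallP[N PN]; exists N.
  by rewrite (eq_integral_sqr_horner _ h hrho).
move=> nu1 nu2 h1 h2.
have n1 := null_of_small_integral (small _ h1) awayP ctL.
have n2 := null_of_small_integral (small _ h2) awayP ctL.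
apply: (eq_measure_on_countable ctL) => // s /onP[Q [c [C [c0 C0 Qs QP]]]].
apply/eqP; rewrite eq_le; apply/andP; split.
- exact: (point_mass_le h1 h2 n2 ctL (small _ h2) c0 C0 Qs QP).
- exact: (point_mass_le h2 h1 n1 ctL (small _ h1) c0 C0 Qs QP).
Qed.

End determinacy_criterion.

(** * Determinacy of the Pearson measures *)

Section pearson_measure.
Context {R : realType}.
Local Notation borel_measure := {measure set (measurableTypeR R) -> \bar R}.
Implicit Types (r a b c t : R) (f : R -> R).

Definition nweight c r a b k := c / wmom r a b 0 * weight r a b k.

Definition pmeasure c r a b : borel_measure :=
  atoms (nweight c r a b) (node r a : nat -> measurableTypeR R).

Lemma nweight_ge0 c r a b k : 0 <= c -> 1 < r -> 0 < a -> 0 < b -> b < a * r ->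
  0 <= nweight c r a b k.
Proof.
by move=> c0 *; rewrite mulr_ge0 ?divr_ge0// ltW// ?wmom0_gt0 ?weight_gt0.
Qed.

Lemma integral_pmeasure c r a b f : 0 <= c -> 1 < r -> 0 < a -> 0 < b -> b < a * r ->
  measurable_fun setT f -> (forall t, 0 <= f t) ->
  (\int[pmeasure c r a b]_t (f t)%:E = (c / wmom r a b 0)%:E * wsum r a b f)%E.
Proof.
move=> c0 r1 a0 b0 bar mf f0; rewrite integral_atoms; last 3 first.
- by move=> k; exact: nweight_ge0.
- exact/measurable_EFinP.
- by move=> t; rewrite lee_fin.
rewrite -nneseriesZl; last first.
  by move=> k _; rewrite lee_fin mulr_ge0// ltW// weight_gt0.
by apply: eq_eseriesr => k _; rewrite -!EFinM mulrA.
Qed.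

Lemma atomic_moments_nweight c r a b :
  0 <= c -> 1 < r -> 0 < a -> 0 < b -> b < a * r ->
  atomic_moments (nweight c r a b) (node r a) (nmom c r a b).
Proof.
move=> c0 r1 a0 b0 bar n; rewrite /nmom EFinM -wmomE// -nneseriesZl; last first.
  move=> k _; rewrite lee_fin mulr_ge0 ?nodeX_ge0//; exact/ltW/weight_gt0.
by apply: eq_eseriesr => k _; rewrite -EFinM mulrA.
Qed.

Lemma S_representing_pmeasure c r a b :
  0 <= c -> 1 < r -> 0 < a -> 0 < b -> b < a * r ->
  S_representing (nmom c r a b) (pmeasure c r a b).
Proof.
move=> c0 r1 a0 b0 bar; apply: S_representing_atoms.
- by move=> k; exact: nweight_ge0.
- by move=> k; exact: node_ge0.
- exact: atomic_moments_nweight.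
Qed.

Definition node_poly r a N : {poly R} := \prod_(k < N) (1 - (node r a k)^-1 *: 'X).

Definition node_poly_but r a j N : {poly R} :=
  \prod_(k < N) (if k == j :> nat then 1 else 1 - (node r a k)^-1 *: 'X).

Lemma horner_node_poly r a N t :
  (node_poly r a N).[t] = \prod_(k < N) (1 - t / node r a k).
Proof.
rewrite horner_prod; apply: eq_bigr => k _.
by rewrite hornerD hornerN hornerZ hornerX hornerC mulrC.
Qed.

Lemma horner_node_poly_but r a j N t : (node_poly_but r a j N).[t] =
  \prod_(k < N) (1 - (if k == j :> nat then 0 else t / node r a k)).
Proof.
rewrite horner_prod; apply: eq_bigr => k _; case: ifPn => _.
  by rewrite hornerC subr0.
by rewrite hornerD hornerN hornerZ hornerX hornerC mulrC.
Qed.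

Lemma node_poly_split r a j N t : (node_poly r a N).[t] =
  (node_poly_but r a j N).[t] * (if (j < N)%N then 1 - t / node r a j else 1).
Proof.
rewrite horner_node_poly horner_node_poly_but.
elim: N => [|N IH]; first by rewrite !big_ord0 mulr1.
rewrite !big_ord_recr/= IH ltnS.
case: (ltngtP N j) => [Nj|jN|Nj]/=; rewrite ?subr0 ?mulr1//.
- by rewrite mulrAC.
- by rewrite -Nj.
Qed.

(** [node_poly r a N.+1] vanishes at the first node, and at [r * t] it is
    [1 - r * t / a] times [node_poly r a N] at [t]. As [b <= a], the square of this
    factor is at most [(r * t - a) * (r * t - b) / a ^+ 2] at the nodes, so the
    Pearson equation yields a factor [b * r / a] for each step. *)
Lemma wsum_sqr_node_poly r a b N : 1 < r -> 0 < b -> b * r < a ->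
  (wsum r a b (fun t => (node_poly r a N).[t] ^+ 2)%R <=
   ((b * r / a) ^+ N)%:E * wsum r a b (fun=> 1)%R)%E.
Proof.
move=> r1 b0 bra; have a0 : 0 < a by nra.
have bar : b < a * r by nra.
have rho0 : 0 <= b * r / a by rewrite divr_ge0// ?mulr_ge0; lra.
elim: N => [|N IH].
  by rewrite expr0 mul1e (@eq_wsum _ _ _ _ _ (fun=> 1))// => k;
     rewrite horner_node_poly big_ord0 expr1n.
have pS t : (node_poly r a N.+1).[r * t] = (1 - r * t / a) * (node_poly r a N).[t].
  rewrite !horner_node_poly big_ord_recl node0; congr (_ * _).
  apply: eq_bigr => k _; rewrite [node r a _]nodeS; congr (1 - _).
  by rewrite -mulf_div divff ?mul1r// gt_eqF//; lra.
rewrite wsum_shift//; last 2 first.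
- by rewrite horner_node_poly big_ord_recl node0 divff ?gt_eqF// subrr mul0r expr0n.
- by move=> k; exact: sqr_ge0.
rewrite exprS EFinM -muleA.
apply: le_trans (lee_wpmul2l _ IH); last by rewrite lee_fin.
rewrite -wsumZ//; last by move=> k; exact: sqr_ge0.
apply: lee_nneseries => k.
  by move=> _ _; rewrite lee_fin mulr_ge0 ?sqr_ge0// ltW// weight_gt0.
move=> _; rewrite lee_fin nodeS pS -nodeS exprMn [leLHS]mulrA [leRHS]mulrA.
apply: ler_wpM2r; first exact: sqr_ge0.
have wP := weight_pearson r1 a0 b0 bar k.
have -> : weight r a b k * (b * r / a) =
    weight r a b k.+1 * ((node r a k.+1 - a) * (node r a k.+1 - b)) / a ^+ 2.
  by rewrite wP; field; rewrite gt_eqF.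
have -> : weight r a b k.+1 * (1 - node r a k.+1 / a) ^+ 2 =
    weight r a b k.+1 * ((node r a k.+1 - a) * (node r a k.+1 - a)) / a ^+ 2.
  by field; rewrite gt_eqF.
rewrite ler_pM2r ?invr_gt0 ?exprn_gt0// ler_pM2l ?weight_gt0//.
have ba : b <= a by nra.
by have t0 := nodeS_suba_gt0 r1 a0 k; rewrite (ler_pM2l t0); lra.
Qed.

Lemma node_ratio_bound r a t k : 1 < r -> 0 < a ->
  `|t / node r a k| <= `|t| / a * r^-1 ^+ k.
Proof.
move=> r1 a0; rewrite normrM normfV (gtr0_norm (node_gt0 r1 a0 k)).
by rewrite /node invfM exprVn mulrA.
Qed.

Lemma node_separated r a i j : 1 < r -> 0 < a -> i != j ->
  (1 - r^-1) ^+ 2 <= (1 - node r a i / node r a j) ^+ 2.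
Proof.
move=> r1 a0; have r0 : 0 < r by lra.
have ri : 0 < r^-1 < 1 by rewrite invr_gt0 r0 invf_lt1.
have rri : r * r^-1 = 1 by rewrite divff// gt_eqF.
rewrite neq_ltn => /orP[ij|ji].
- have : node r a i / node r a j <= r^-1.
    rewrite ler_pdivrMr ?node_gt0// mulrC ler_pdivlMr// mulrC -nodeS /node.
    by rewrite ler_pM2l// ler_eXn2l.
  have : 0 <= node r a i / node r a j by rewrite divr_ge0// node_ge0.
  by move: (_ / _) (r^-1) ri => x y; nra.
- have : r <= node r a i / node r a j.
    rewrite ler_pdivlMr ?node_gt0// -nodeS /node.
    by rewrite ler_pM2l// ler_eXn2l.
  have : 1 - r^-1 <= r - 1 by move: (r^-1) ri rri => x; nra.
  by move: (_ / _) (r^-1) ri => y x; nra.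
Qed.

(** The condition [b * r < a] makes [node_poly r a N] small in mean square. It is
    bounded away from 0 outside the nodes, and without its factor at one node it is
    bounded away from 0 at this node too, because the nodes grow geometrically. *)
Lemma H_determinate_nmom c r a b : 0 <= c -> 1 < r -> 0 < b -> b * r < a ->
  H_determinate (nmom c r a b).
Proof.
move=> c0 r1 b0 bra; have a0 : 0 < a by nra.
have bar : b < a * r by nra.
have rho01 : 0 < b * r / a < 1.
  by rewrite divr_gt0 ?ltr_pdivrMr ?mul1r// mulr_gt0//; lra.
have ri01 : 0 < r^-1 < 1 by rewrite invr_gt0 invf_lt1; lra.
have t0 := node_gt0 r1 a0.
apply: (@H_determinate_criterion _ _ (pmeasure c r a b) (node_poly r a)
  (range (node r a))).
- exact/S_representing_H/S_representing_pmeasure.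
- by apply: sub_countable (countableP [set: nat]); exact: card_image_le.
- move=> e e0; have [N cN] := geometric_small c e0 rho01; exists N.
  rewrite integral_pmeasure//; last 2 first.
  + by apply: measurable_funX; apply: continuous_measurable_fun; exact/continuous_horner.
  + by move=> t; exact: sqr_ge0.
  apply: (@le_trans _ _ ((c / wmom r a b 0)%:E *
      (((b * r / a) ^+ N)%:E * wsum r a b (fun=> 1)%R))%E).
    apply: lee_wpmul2l; last exact: wsum_sqr_node_poly.
    by rewrite lee_fin divr_ge0// ltW// wmom0_gt0.
  rewrite (@eq_wsum _ _ _ _ _ (fun t => t ^+ 0))// wmomE// -!EFinM lee_fin.
  by rewrite mulrCA divfK 1?mulrC// gt_eqF// wmom0_gt0.
- move=> t nt; have [||k|k|e e0 eN] :=
      @prod_1subr_bounded_away _ (`|t| / a) r^-1 (fun k => t / node r a k).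
  + by rewrite divr_ge0// ltW.
  + by [].
  + apply/eqP => h; apply: nt; exists k => //.
    by rewrite -[RHS](divfK (lt0r_neq0 (t0 k))) h mul1r.
  + exact: node_ratio_bound.
  exists (e ^+ 2); first by rewrite exprn_gt0.
  move=> N; rewrite -[leRHS]real_normK ?num_real// horner_node_poly.
  by rewrite ler_pXn2r// nnegrE// ltW.
- move=> _ [j _ <-].
  have [||k|k|e e0 eN] := @prod_1subr_bounded_away _ (`|node r a j| / a) r^-1
      (fun k => if k == j then 0 else node r a j / node r a k).
  + by rewrite divr_ge0// ltW.
  + by [].
  + case: (eqVneq k j) => [_|kj]; first by rewrite eq_sym oner_eq0.
    rewrite eq_sym in kj; apply/negP => /eqP h.
    have := node_separated r1 a0 kj; rewrite h subrr expr0n/=.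
    by apply/negP; rewrite -ltNge exprn_gt0//; lra.
  + case: (eqVneq k j) => [_|_]; last exact: node_ratio_bound.
    rewrite normr0 mulr_ge0 ?divr_ge0 ?exprn_ge0// ?invr_ge0; lra.
  exists (node_poly_but r a j), (e ^+ 2), ((1 - r^-1) ^- 2); split.
  + by rewrite exprn_gt0.
  + by rewrite invr_ge0 sqr_ge0.
  + move=> N; rewrite -[leRHS]real_normK ?num_real// horner_node_poly_but.
    by rewrite ler_pXn2r// nnegrE// ltW.
  + move=> N _ [i _ <-] ij.
    have {}ij : i != j by apply: contra ij => /eqP ->.
    rewrite ler_pdivlMl; last by rewrite exprn_gt0//; lra.
    rewrite (node_poly_split _ _ j) exprMn mulrC; apply: ler_wpM2l; first exact: sqr_ge0.
    case: ifPn => _; first exact: node_separated.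
    by rewrite expr1n exprn_ile1//; lra.
Qed.

End pearson_measure.

(** * Indices of determinacy *)

Section index.
Context {R : realType}.
Local Notation borel_measure := {measure set (measurableTypeR R) -> \bar R}.
Implicit Types (nu rho : borel_measure) (gamma : nat -> R).
Implicit Types (w : nat -> R) (x : nat -> measurableTypeR R).

Lemma cabs_real (t : R) k : cabs (t%:C%C - 0) ^+ (2 * k) = t ^+ (2 * k).
Proof.
by rewrite subr0 /= expr0n/= addr0 sqrtr_sqr exprM real_normK ?num_real// -exprM.
Qed.

Lemma weighted_atoms w x k (A : set (measurableTypeR R)) : (forall i, 0 <= w i) ->
  measurable A -> weighted (atoms w x) 0 k A =
    atoms (fun i => w i * (x i : R) ^+ (2 * k)) x A.
Proof.
move=> w0 mA; have p0 (t : R) : 0 <= t ^+ (2 * k) by rewrite exprM exprn_ge0// sqr_ge0.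
rewrite /weighted integral_mkcond integral_atoms//; last 2 first.
- apply/(measurable_restrictT _ mA); apply: measurable_funTS.
  apply: eq_measurable_fun (measurable_exprn (2 * k)) => t _.
  by rewrite cabs_real.
- by move=> t; rewrite patchE; case: ifPn => // _; rewrite cabs_real lee_fin.
rewrite atomsE; last by move=> i; rewrite mulr_ge0.
apply: eq_eseriesr => i _; rewrite patchE; case: ifPn => _.
  by rewrite cabs_real mulr1 EFinM.
by rewrite mulr0 mule0.
Qed.

Lemma weighted_neg w x k : (forall i, 0 <= w i) -> (forall i, 0 <= (x i : R)) ->
  weighted (atoms w x) 0 k [set t : R | t < 0] = 0%E.
Proof.
move=> w0 x0; rewrite weighted_atoms//; last first.
  by apply: open_measurable; exact: open_lt.
by apply: atoms_neg => // i; rewrite mulr_ge0// exprn_ge0.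
Qed.

Lemma integral_norm_weighted gamma w x k n : (forall i, 0 <= w i) ->
  (forall i, 0 <= (x i : R)) -> atomic_moments w x gamma ->
  (\int[weighted (atoms w x) 0%R k]_t (`|t : R| ^+ n)%:E = (gamma (n + 2 * k)%N)%:E)%E.
Proof.
move=> w0 x0 mom.
rewrite (eq_measure_integral (atoms (fun i => w i * (x i : R) ^+ (2 * k)) x));
  last by move=> A mA _; exact: weighted_atoms.
rewrite integral_norm_atoms//; last by move=> i; rewrite mulr_ge0// exprn_ge0.
by rewrite -mom; apply: eq_eseriesr => i _; rewrite -mulrA -exprD addnC.
Qed.

Lemma S_representing_weighted gamma w x k : (forall i, 0 <= w i) ->
  (forall i, 0 <= (x i : R)) -> atomic_moments w x gamma ->
  S_representing (fun n => gamma (n + 2 * k)%N) (weighted (atoms w x) 0 k).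
Proof.
move=> w0 x0 mom; apply: S_representing_nonneg; first exact: weighted_neg.
by move=> n; exact: integral_norm_weighted.
Qed.

Lemma H_determinate_measureE gamma nu : H_representing gamma nu ->
  H_determinate_measure nu <-> H_determinate gamma.
Proof.
move=> h; have -> : gamma = moment_seq nu.
  by apply/funext => n; rewrite /moment_seq -(proj2 h).
by split=> [[]//|d]; split=> //; case: h.
Qed.

Lemma H_determinate_weighted gamma w x k : (forall i, 0 <= w i) ->
  (forall i, 0 <= (x i : R)) -> atomic_moments w x gamma ->
  H_determinate_measure (weighted (atoms w x) 0 k) <->
  H_determinate (fun n => gamma (n + 2 * k)%N).
Proof.
by move=> *; apply/H_determinate_measureE/S_representing_H/S_representing_weighted.
Qed.

(** A point mass is treated as a sequence of atoms located at one point, all but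
    the first of which have mass 0, so that the lemmas on [atoms] apply to it. *)
Definition point_weight (c : R) (k : nat) : R := if k is 0 then c else 0.

Definition point_measure (c t : R) : borel_measure :=
  atoms (point_weight c) (fun=> t : measurableTypeR R).

Lemma atomic_moments_point (c t : R) : 0 <= c -> 0 <= t ->
  atomic_moments (point_weight c) (fun=> t) (fun n => c * t ^+ n).
Proof.
move=> c0 t0 n; rewrite nneseries_recl//; last first.
  by case=> [|k] _; rewrite lee_fin ?mul0r// mulr_ge0// exprn_ge0.
by rewrite eseries0 ?adde0// => -[//|k] _ _; rewrite mul0r.
Qed.

Lemma S_representing_point (c t : R) : 0 <= c -> 0 <= t ->
  S_representing (fun n => c * t ^+ n) (point_measure c t).
Proof.
move=> c0 t0; apply: S_representing_atoms; [by case|by []|].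
exact: atomic_moments_point.
Qed.

(** The square of ['X - t] has integral 0, so the criterion holds with constant
    sequences of polynomials. *)
Lemma H_determinate_point (c t : R) : 0 <= c -> 0 <= t ->
  H_determinate (fun n => c * t ^+ n).
Proof.
move=> c0 t0; have p0 k : 0 <= point_weight c k by case: k.
apply: (@H_determinate_criterion _ _ (point_measure c t)
  (fun=> 'X - t%:P) [set t]).
- exact/S_representing_H/S_representing_point.
- exact: countable1.
- move=> e e0; exists 0%N; rewrite integral_atoms//.
  + rewrite eseries0 ?lee_fin ?ltW// => k _ _.
    by rewrite hornerXsubC subrr expr0n mule0.
  + exact: measurable_sqr_horner.
  + by move=> s; rewrite lee_fin sqr_ge0.
- move=> s /eqP st; exists ((s - t) ^+ 2); last by move=> _; rewrite hornerXsubC.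
  by rewrite lt_neqAle sqr_ge0 eq_sym sqrf_eq0 subr_eq0 st.
- move=> _ ->; exists (fun=> 1), 1, 0; split => // [_|_ s ->].
    by rewrite hornerC expr1n.
  by rewrite eqxx.
Qed.

Lemma infinite_index_point (t : R) : 0 <= t -> infinite_index (fun n => t ^+ n).
Proof.
move=> t0; exists 0; have p0 k : 0 <= point_weight (1 : R) k by case: k.
have mom : atomic_moments (point_weight 1) (fun=> t) (fun n => t ^+ n).
  by move=> n; rewrite atomic_moments_point// mul1r.
exists (point_measure 1 t).
  exact/S_representing_H/S_representing_atoms.
have all k : H_determinate_measure (weighted (point_measure 1 t) 0 k).
  apply/(H_determinate_weighted k p0 (fun=> t0) mom).
  have -> : (fun n => t ^+ (n + 2 * k)) = (fun n => t ^+ (2 * k) * t ^+ n).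
    by apply/funext => n; rewrite addnC exprD.
  by apply: H_determinate_point => //; rewrite exprn_ge0.
have up k : (k%:R%:E <= measure_index 0%R (point_measure 1 t))%E.
  by apply: ereal_sup_ubound; exists k => //; exact: all.
move: up; case: (measure_index _ _) => [y|//|] up.
  by have := up (Num.truncn y).+1; rewrite lee_fin leNgt truncnS_gt.
by have := up 0%N; rewrite leeNy_eq.
Qed.

(** Let [nu] be [pmeasure 1 r a 1] and [tau] be [pmeasure a r r a]. As
    [t ^+ 2 = (t - 1) * (t + 1) + 1] and [(t - 1) * nu] has the moments of [tau],
    the measures [t ^+ (2 * k + 2) * nu] and [t ^+ (2 * k) * ((t + 1) * tau + nu)]
    have the same moments; only the second one charges [r], the first atom of
    [tau]. *)
Lemma weighted_pmeasure_indeterminate (r a : R) k : 1 < r -> r < a -> a < r ^+ 2 ->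
  ~ H_determinate_measure (weighted (pmeasure 1 r a 1) 0 k.+1).
Proof.
move=> r1 ra ar2; have a0 : 0 < a by lra.
have r0 : 0 < r by lra.
have ar1 : 1 < a * r by nra.
have arr : a < r * r by rewrite -expr2.
have w0 i : 0 <= nweight 1 r a 1 i by exact: nweight_ge0.
have x0 i : 0 <= node r a i by exact: node_ge0.
have v0 i : 0 <= nweight a r r a i by apply: nweight_ge0 => //; exact: ltW.
have s0 i : 0 <= node r r i by exact: node_ge0.
have momw : atomic_moments (nweight 1 r a 1) (node r a) (nmom 1 r a 1).
  exact: atomic_moments_nweight.
have momv : atomic_moments (nweight a r r a) (node r r) (nmom a r r a).
  by apply: atomic_moments_nweight => //; exact: ltW.
rewrite (H_determinate_weighted k.+1 w0 x0 momw) => -[_ uniq].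
pose u i := nweight a r r a i * (node r r i ^+ (2 * k) * (node r r i + 1)).
have u0 i : 0 <= u i by rewrite mulr_ge0// mulr_ge0 ?exprn_ge0// addr_ge0.
pose nu2 : borel_measure := measure_add (atoms u (node r r : nat -> measurableTypeR R))
  (weighted (pmeasure 1 r a 1) 0 k).
have rep2 : S_representing (fun n => nmom 1 r a 1 (n + 2 * k.+1)%N) nu2.
  apply: S_representing_nonneg.
    by rewrite [LHS]measure_addE atoms_neg// [X in (_ + X)%E]weighted_neg// adde0.
  move=> n; rewrite ge0_integral_measure_add//; last exact: measurable_norm_exprn.
  rewrite (integral_norm_weighted k n w0 x0 momw) integral_norm_atoms//.
  rewrite (@eq_eseriesr _ _ (fun i =>
      ((nweight a r r a i * node r r i ^+ (n + 2 * k).+1)%:E +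
       (nweight a r r a i * node r r i ^+ (n + 2 * k))%:E)%E)); last first.
    by move=> i _; rewrite /u -EFinD -mulrDr -mulrA exprS exprD; congr (_ * _)%:E; ring.
  rewrite nneseriesD; last 2 first.
  - by move=> i _ _; rewrite lee_fin mulr_ge0// exprn_ge0.
  - by move=> i _ _; rewrite lee_fin mulr_ge0// exprn_ge0.
  rewrite !momv -!EFinD -!nmom_diff// mulnS addnA addnAC addn2.
  by congr EFin; ring.
have mr : measurable ([set r] : set (measurableTypeR R)) by exact: measurable_set1.
have := uniq _ _ (S_representing_H (S_representing_weighted k.+1 w0 x0 momw))
  (S_representing_H rep2) _ mr.
rewrite [LHS]weighted_atoms// atomsE; last by move=> i; rewrite mulr_ge0// exprn_ge0.
rewrite eseries0; last first.
  move=> i _ _; rewrite memNset ?mulr0//= => h.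
  by have := le_node r1 a0 i; rewrite h leNgt ra.
apply/eqP; rewrite eq_sym gt_eqF// [ltRHS]measure_addE.
apply: (@lt_le_trans _ _ (u 0%N)%:E).
  rewrite lte_fin /u node0; apply: mulr_gt0.
    by rewrite /nweight mulr1 divr_gt0// wmom0_gt0.
  by rewrite mulr_gt0 ?exprn_gt0 ?addr_gt0.
apply: (@le_trans _ _ (atoms u (node r r : nat -> measurableTypeR R) [set r])); last by rewrite leeDl.
rewrite atomsE//; apply: le_trans (nneseries_lim_ge 1 _).
  by rewrite big_nat1 node0 mem_set// mulr1.
by move=> i _ _; rewrite lee_fin mulr_ge0.
Qed.

Lemma has_index_nmom (r a : R) : 1 < r -> r < a -> a < r ^+ 2 ->
  has_index (nmom 1 r a 1) 0 0%E.
Proof.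
move=> r1 ra ar2; have a0 : 0 < a by lra.
have ar1 : 1 < a * r by nra.
exists (pmeasure 1 r a 1).
  by apply/S_representing_H/S_representing_pmeasure.
rewrite /measure_index.
rewrite (_ : [set k | _] = [set 0%N]) ?image_set1 ?ereal_sup1//.
apply/seteqP; split => [[|k]//= /(weighted_pmeasure_indeterminate r1 ra ar2)//|_ ->].
apply/(@H_determinate_weighted (nmom 1 r a 1)).
- by move=> i; exact: nweight_ge0.
- by move=> i; exact: node_ge0.
- exact: atomic_moments_nweight.
- have -> : (fun n => nmom 1 r a 1 (n + 2 * 0)) = nmom 1 r a 1.
    by apply/funext => n; rewrite addn0.
  by apply: H_determinate_nmom => //; rewrite mul1r.
Qed.

(** The mean of the normalized measure is [r + a], and all its atoms but the first
    one, which is [r], are at least [r ^+ 2]; so the mass at [r] cannot be too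
    small. *)
Lemma first_nweight_ge (r a : R) : 1 < r -> 0 < a -> a < r ^+ 2 ->
  a * (r ^+ 2 - r - a) <= (r ^+ 2 - r) * nweight a r r a 0.
Proof.
move=> r1 a0 ar2; have r0 : 0 < r by lra.
have arr : a < r * r by rewrite -expr2.
have v0 i : 0 <= nweight a r r a i by apply: nweight_ge0 => //; exact: ltW.
have mom : atomic_moments (nweight a r r a) (node r r) (nmom a r r a).
  by apply: atomic_moments_nweight => //; exact: ltW.
(* What [r * w_0] lacks to be [r ^+ 2 * w_0]. *)
pose c := (r ^+ 2 - r) * nweight a r r a 0.
have c0 : 0 <= c by rewrite mulr_ge0//; nra.
have : ((r ^+ 2 * nmom a r r a 0)%:E <= (nmom a r r a 1 + c)%:E)%E.
  have := @atomic_moments_point c 1 c0 ler01 0; rewrite expr0 mulr1 => cE.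
  rewrite EFinD EFinM -!mom -cE -nneseriesZl; last first.
    by move=> i _; rewrite lee_fin mulr_ge0.
  rewrite -nneseriesD; last 2 first.
  - by move=> i _ _; rewrite lee_fin mulr_ge0// exprn_ge0// node_ge0.
  - by move=> i _ _; rewrite lee_fin mulr_ge0// /point_weight; case: i.
  apply: lee_nneseries => [i _ _|[|i] _].
  - by rewrite -EFinM lee_fin mulr_ge0// ?sqr_ge0// mulr_ge0.
  - by rewrite -EFinM -EFinD lee_fin node0 /= /c; lra.
  - rewrite -EFinM -EFinD lee_fin/= mul0r addr0 expr0 expr1 mulr1 mulrC.
    by apply: ler_wpM2l => //; rewrite expr2; exact: leS_node.
rewrite lee_fin nmom0//.
have [-> _] : pearson_moments r r a (nmom a r r a) by exact: pearson_moments_nmom.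
by rewrite nmom0// /c; lra.
Qed.

End index.

(** * The measure on the vertices *)

Section comb_measure.
Context {R : realType} d (T : measurableType d).
Implicit Types (nu : {measure set T -> \bar R}) (m : nat -> nat -> R).
Implicit Types (x : nat -> nat -> T).

Definition comb (nu : {measure set T -> \bar R}) m x : {measure set T -> \bar R} :=
  measure_add nu (mseries (fun i => atoms (m i) (x i)) 0).

Lemma integral_comb nu m x (f : T -> \bar R) : (forall i j, 0 <= m i j) ->
  measurable_fun setT f -> (forall t, 0 <= f t)%E ->
  (\int[comb nu m x]_t f t =
   \int[nu]_t f t + \sum_(i <oo) \sum_(j <oo) ((m i j)%:E * f (x i j)))%E.
Proof.
move=> mpos mf f0; rewrite ge0_integral_measure_add//; congr (_ + _)%E.
rewrite ge0_integral_measure_series//; apply: eq_eseriesr => i _.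
by rewrite integral_atoms.
Qed.

Lemma combE nu m x (A : set T) : (forall i j, 0 <= m i j) ->
  (comb nu m x A = nu A + \sum_(i <oo) \sum_(j <oo) (m i j * (x i j \in A)%:R)%:E)%E.
Proof.
move=> mpos; rewrite [LHS]measure_addE; congr (_ + _)%E.
by rewrite /= /mseries; apply: eq_eseriesr => i _; rewrite atomsE.
Qed.

End comb_measure.

Section vertices.

Lemma vertex_measurable (A : set vertex) : measurable A.
Proof. by []. Qed.

Lemma vertex_measurable_fun d (T : measurableType d) (f : vertex -> T) D :
  measurable_fun D f.
Proof. by move=> _ B _; exact: vertex_measurable. Qed.

Lemma iter_phi_X0 n : iter n phi_infty0 X0 = X0.
Proof. by elim: n => //= n ->. Qed.

Lemma iter_phi_Xarm n i j : iter n phi_infty0 (Xarm i j) =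
  if (n <= j)%N then Xarm i (j - n) else X0.
Proof.
elim: n j => [|n IH] j; first by rewrite subn0.
by rewrite iterSr; case: j => [|j] /=; [exact: iter_phi_X0|rewrite IH ltnS subSS].
Qed.

Lemma phi_surjective x : exists y, phi_infty0 y = x.
Proof. by case: x => [|i j]; [exists X0|exists (Xarm i j.+1)]. Qed.

End vertices.

(** The arms carry geometric weights, and [gammaS] makes the preimages of [X0] under
    the iterates have the masses [gamma n]. *)
Section geometric_arms.
Context {R : realType}.
Variables (a s gamma w x : nat -> R).
Hypotheses (a_gt0 : forall i, 0 < a i) (s_gt0 : forall i, 0 < s i).
Hypotheses (w_ge0 : forall k, 0 <= w k) (x_ge0 : forall k, 0 <= x k).
Hypotheses (gamma0 : gamma 0%N = 1) (gammaP : atomic_moments w x gamma).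
Hypothesis gammaS : atomic_moments a s (fun n => gamma n.+1 - gamma n).
Local Notation phi := phi_infty0.

Definition arm_weight i j := a i * s i ^+ j.

Definition graph_measure : {measure set vertex -> \bar R} :=
  comb \d_X0 arm_weight Xarm.

Local Notation mu := graph_measure.

Lemma arm_weight_gt0 i j : 0 < arm_weight i j.
Proof. by rewrite mulr_gt0// exprn_gt0. Qed.

Lemma arm_weight_ge0 i j : 0 <= arm_weight i j.
Proof. exact/ltW/arm_weight_gt0. Qed.

Lemma integral_graph (f : vertex -> R) : (forall v, 0 <= f v) ->
  (\int[mu]_v (f v)%:E =
   (f X0)%:E + \sum_(i <oo) \sum_(j <oo) (arm_weight i j * f (Xarm i j))%:E)%E.
Proof.
move=> f0; rewrite integral_comb.
- rewrite integral_dirac ?diracT ?mul1e//; exact: vertex_measurable_fun.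
- exact: arm_weight_ge0.
- exact: vertex_measurable_fun.
- by move=> v; rewrite lee_fin.
Qed.

Lemma sum_arm_weight n :
  (\sum_(i <oo) (\sum_(0 <= j < n) arm_weight i j)%:E = (gamma n - 1)%:E)%E.
Proof.
under eq_eseriesr do rewrite -sumEFin.
rewrite nneseries_sum_nat; last by move=> i j; rewrite lee_fin arm_weight_ge0.
transitivity (\sum_(0 <= j < n) (gamma j.+1 - gamma j)%:E)%E.
  by apply: eq_bigr => j _; rewrite -gammaS.
by rewrite sumEFin telescope_sumr// gamma0.
Qed.

(** Change of variables: the density of the image of [mu] under the iterates of
    [phi] is [gamma n] at [X0] and [s i ^+ n] on the [i]-th arm. *)
Lemma integral_graph_iter (f : vertex -> R) n : (forall v, 0 <= f v) ->
  (\int[mu]_v (f (iter n phi v))%:E =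
   (gamma n * f X0)%:E +
   \sum_(i <oo) \sum_(j <oo) (arm_weight i j * s i ^+ n * f (Xarm i j))%:E)%E.
Proof.
move=> f0; rewrite (@integral_graph (fun v => f (iter n phi v)))// iter_phi_X0.
have arm0 i j : (0 <= (arm_weight i j * s i ^+ n * f (Xarm i j))%:E)%E.
  by rewrite lee_fin !mulr_ge0 ?arm_weight_ge0 ?exprn_ge0// ltW.
have armE i : (\sum_(j <oo) (arm_weight i j * f (iter n phi (Xarm i j)))%:E =
    (f X0)%:E * (\sum_(0 <= j < n) arm_weight i j)%:E +
    \sum_(j <oo) (arm_weight i j * s i ^+ n * f (Xarm i j))%:E)%E.
  rewrite (@nneseries_split _ _ 0 n); last first.
    by move=> k _; rewrite lee_fin mulr_ge0 ?arm_weight_ge0.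
  congr (_ + _)%E.
    rewrite sumEFin -EFinM mulr_sumr; congr EFin.
    apply: eq_big_nat => j /andP[_ jn].
    by rewrite iter_phi_Xarm leqNgt jn mulrC.
  rewrite add0n -nneseries_addn; last first.
    by move=> k; rewrite lee_fin mulr_ge0 ?arm_weight_ge0.
  apply: eq_eseriesr => j _.
  by rewrite iter_phi_Xarm leq_addl addnK /arm_weight exprD mulrA.
under eq_eseriesr do rewrite armE.
rewrite nneseriesD; last 2 first.
- by move=> i _ _; rewrite -EFinM lee_fin mulr_ge0// sumr_ge0// => j _; exact: arm_weight_ge0.
- by move=> i _ _; exact: nneseries_ge0.
rewrite nneseriesZl; last first.
  by move=> i _; rewrite lee_fin sumr_ge0// => j _; exact: arm_weight_ge0.
rewrite sum_arm_weight addeA; congr (_ + _)%E.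
by rewrite -EFinM -EFinD; congr EFin; ring.
Qed.

Lemma graph_measure_preimage n (A : set vertex) :
  (mu (iter n phi @^-1` A) = (gamma n * (X0 \in A)%:R)%:E +
   \sum_(i <oo) \sum_(j <oo) (arm_weight i j * s i ^+ n * (Xarm i j \in A)%:R)%:E)%E.
Proof.
rewrite -(integral_graph_iter n (f := fun v => (v \in A)%:R)); last by move=> v; rewrite ler0n.
rewrite -[LHS]mul1e -(integral_cst mu (vertex_measurable _)).
rewrite integral_mkcond; apply: eq_integral => v _.
rewrite patchE; case: ifPn => [/set_mem h|/negP h]; first by rewrite mem_set.
by rewrite memNset// => h'; apply: h; exact/mem_set.
Qed.

Lemma esum_Xarm1 (c : nat -> nat -> R) i j : (forall i j, 0 <= c i j) ->
  (\sum_(k <oo) \sum_(l <oo) (c k l * (Xarm k l \in [set Xarm i j])%:R)%:E =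
   (c i j)%:E)%E.
Proof.
move=> c0; rewrite (@nneseriesD1 _ _ i)//; last first.
  by move=> k _; apply: nneseries_ge0 => l _ _; rewrite lee_fin mulr_ge0.
rewrite [X in (_ + X)%E]eseries0 ?adde0; last first.
  move=> k _ /= ki; rewrite eseries0// => l _ _.
  by rewrite memNset ?mulr0//= => -[/eqP]; rewrite (negbTE ki).
rewrite (@nneseriesD1 _ _ j)//; last by move=> l _; rewrite lee_fin mulr_ge0.
rewrite [X in (_ + X)%E]eseries0 ?adde0; last first.
  move=> l _ /= lj; rewrite memNset ?mulr0//= => -[/eqP].
  by rewrite (negbTE lj).
by rewrite mem_set// mulr1.
Qed.

Lemma graph_measure_preimage_X0 n : mu (iter n phi @^-1` [set X0]) = (gamma n)%:E.
Proof.
rewrite graph_measure_preimage mem_set// mulr1 eseries0 ?adde0// => i _ _.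
by rewrite eseries0// => j _ _; rewrite memNset ?mulr0.
Qed.

Lemma graph_measure_preimage_Xarm n i j :
  mu (iter n phi @^-1` [set Xarm i j]) = (arm_weight i j * s i ^+ n)%:E.
Proof.
rewrite graph_measure_preimage memNset// mulr0 add0e.
rewrite (esum_Xarm1 (c := fun i j => arm_weight i j * s i ^+ n))//.
by move=> k l; rewrite mulr_ge0 ?arm_weight_ge0// exprn_ge0// ltW.
Qed.

Lemma graph_measure1_X0 : mu [set X0] = 1%E.
Proof. by have := graph_measure_preimage_X0 0; rewrite gamma0. Qed.

Lemma graph_measure1_Xarm i j : mu [set Xarm i j] = (arm_weight i j)%:E.
Proof. by have := graph_measure_preimage_Xarm 0 i j; rewrite mulr1. Qed.

Lemma graph_measure1_lty v : (mu [set v] < +oo)%E.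
Proof. by case: v => [|i j]; rewrite ?graph_measure1_X0 ?graph_measure1_Xarm ltry. Qed.

Lemma discrete_graph_measure : discrete_measure mu.
Proof.
split; first exact: vertex_measurable.
- exists (fun n => if unpickle n is Some v then [set v] else set0).
    apply/seteqP; split => // v _; exists (pickle v) => //.
    by rewrite pickleK.
  move=> n; split; first exact: vertex_measurable.
  by case: unpickle => [v|]; [exact: graph_measure1_lty|rewrite measure0].
- case=> [|i j]; rewrite ?graph_measure1_X0 ?graph_measure1_Xarm ?lte01//.
  by rewrite lte_fin arm_weight_gt0.
Qed.

Lemma h_X0 n : h_ mu phi n X0 = (gamma n)%:E.
Proof. by rewrite /h_ graph_measure_preimage_X0 graph_measure1_X0 inve1 mule1. Qed.

Lemma h_Xarm n i j : h_ mu phi n (Xarm i j) = (s i ^+ n)%:E.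
Proof.
rewrite /h_ graph_measure_preimage_Xarm graph_measure1_Xarm.
rewrite inver gt_eqF ?arm_weight_gt0// -EFinM mulrAC divff ?mul1r//.
by rewrite gt_eqF// arm_weight_gt0.
Qed.

(** * The composition operator *)

Local Notation C_phi := (composition_op mu phi).
Implicit Types f g : vertex -> R[i].

Lemma L2P f : L2 mu f <-> (\int[mu]_v (cabs (f v) ^+ 2)%:E < +oo)%E.
Proof. by []. Qed.

Lemma iter_composition_op n f : iter n C_phi f = f \o iter n phi.
Proof.
elim: n => [|n IH]; first by apply/funext.
by rewrite iterS IH; apply/funext => v; rewrite /= -iterSr.
Qed.

Lemma dom_inftyP f :
  dom_infty mu C_phi f <-> forall n, L2 mu (f \o iter n phi).
Proof.
split=> [f_dom n|f_L2 n _].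
- move: (f_dom n Logic.I); by elim: n f {f_dom} => [//|n IH] f /= [_ /IH].
- elim: n f f_L2 => [|n IH] f f_L2; first exact: (f_L2 0%N).
  split; first by split; [exact: (f_L2 0%N)|exact: (f_L2 1%N)].
  by apply: IH => k; exact: (f_L2 k.+1).
Qed.

Lemma sqr_cabs_ge0 f v : 0 <= cabs (f v) ^+ 2.
Proof. by rewrite exprn_ge0//; case: (f v) => p q; exact: sqrtr_ge0. Qed.

Lemma sqr_L2norm f : L2 mu f ->
  ((L2norm mu f ^+ 2)%:E = \int[mu]_v (cabs (f v) ^+ 2)%:E)%E.
Proof.
move=> f_L2; have int0 : (0 <= \int[mu]_v (cabs (f v) ^+ 2)%:E)%E.
  by apply: integral_ge0 => v _; rewrite lee_fin sqr_cabs_ge0.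
rewrite /L2norm sqr_sqrtr ?fine_ge0// fineK// ge0_fin_numE//.
Qed.

Lemma injective_composition_op : injective_op C_phi.
Proof.
move=> f g _ _ fg; apply/funext => v; have [u <-] := phi_surjective v.
exact: (congr1 (fun h => h u) fg).
Qed.

(** By the change of variables, the squared norms are the moments of the sum over
    the vertices [v] of [mu [set v] * cabs (f v) ^+ 2] times a measure that
    represents the sequence [h_ mu phi n v]. *)
Lemma Stieltjes_sqr_norms f : dom_infty mu C_phi f ->
  Stieltjes (fun n => L2norm mu (iter n C_phi f) ^+ 2).
Proof.
move=> /dom_inftyP f_L2; pose F v := cabs (f v) ^+ 2.
have F0 v : 0 <= F v by exact: sqr_cabs_ge0.
have FX0 k : 0 <= F X0 * w k by rewrite mulr_ge0.
have armF i j : 0 <= arm_weight i j * F (Xarm i j) by rewrite mulr_ge0// arm_weight_ge0.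
pose kappa : {measure set (measurableTypeR R) -> \bar R} :=
  comb (atoms (fun k => F X0 * w k) (x : nat -> measurableTypeR R))
    (fun i j => arm_weight i j * F (Xarm i j))
    (fun i _ => s i : measurableTypeR R).
exists kappa; apply: S_representing_nonneg.
- rewrite combE// atoms_neg// add0e eseries0// => i _ _; rewrite eseries0// => j _ _.
  by rewrite memNset ?mulr0//= ltNge ltW.
- move=> n; rewrite iter_composition_op sqr_L2norm//.
  rewrite (@integral_graph_iter F)//.
  rewrite integral_comb//; last exact: measurable_norm_exprn.
  rewrite integral_norm_atoms//; congr (_ + _)%E.
    rewrite mulrC EFinM -gammaP -nneseriesZl; last first.
      by move=> k _; rewrite lee_fin mulr_ge0// exprn_ge0.
    by apply: eq_eseriesr => k _; rewrite -EFinM mulrA.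
  apply: eq_eseriesr => i _; apply: eq_eseriesr => j _.
  by rewrite -EFinM gtr0_norm// mulrAC.
Qed.

Definition corner N v : bool := if v is Xarm i j then (i < N)%N && (j < N)%N else true.

Definition truncation f N : vertex -> R[i] := fun v => if corner N v then f v else 0.

Lemma truncation0 f N v : ~~ corner N v -> truncation f N v = 0.
Proof. by rewrite /truncation => /negbTE ->. Qed.

Lemma nneseries_eventually0_lty (u : nat -> \bar R) N : (forall k, 0 <= u k)%E ->
  (forall k, u k < +oo)%E -> (forall k, (N <= k)%N -> u k = 0%E) ->
  (\sum_(k <oo) u k < +oo)%E.
Proof.
move=> u0 u_fin uN; rewrite (@nneseries_split _ _ 0 N)// add0n.
rewrite [X in (_ + X)%E]eseries0 ?adde0; last by move=> k Nk _; exact: uN.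
by apply: lte_sum_pinfty.
Qed.

Lemma cabs0 : cabs (0 : R[i]) = 0. Proof. exact: ComplexField.Normc.normc0. Qed.

Lemma cabs1 : cabs (1 : R[i]) = 1. Proof. exact: ComplexField.Normc.normc1. Qed.

Lemma dom_infty_truncation f N : dom_infty mu C_phi (truncation f N).
Proof.
apply/dom_inftyP => n; apply/L2P.
pose F v := cabs (truncation f N v) ^+ 2.
have F0 v : 0 <= F v by exact: sqr_cabs_ge0.
rewrite (integral_graph_iter n F0); apply: lte_add_pinfty; first exact: ltry.
have t0 i j : (0 <= (arm_weight i j * s i ^+ n * F (Xarm i j))%:E)%E.
  by rewrite lee_fin mulr_ge0// mulr_ge0 ?arm_weight_ge0// exprn_ge0// ltW.
apply: (@nneseries_eventually0_lty _ N) => [i|i|i Ni].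
- exact: nneseries_ge0.
- apply: (@nneseries_eventually0_lty _ N) => // [j|j Nj]; first exact: ltry.
  by rewrite /F truncation0 ?cabs0 ?expr0n ?mulr0//= [(j < N)%N]ltnNge Nj andbF.
- rewrite eseries0// => j _ _.
  by rewrite /F truncation0 ?cabs0 ?expr0n ?mulr0//= ltnNge Ni.
Qed.

(** The truncations of [f] to the corners converge to [f] by dominated
    convergence. *)
Lemma dense_dom_infty : L2dense mu (dom_infty mu C_phi).
Proof.
move=> f f_L2 e e0.
pose D N v := cabs (f v - truncation f N v) ^+ 2.
have DE N v : D N v = if corner N v then 0 else cabs (f v) ^+ 2.
  by rewrite /D /truncation; case: ifP => _; rewrite ?subrr ?subr0// cabs0 expr0n.
have D0 N v : 0 <= D N v by exact: (@sqr_cabs_ge0 (fun v => f v - truncation f N v)).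
have Df N v : D N v <= cabs (f v) ^+ 2.
  by rewrite DE; case: ifP => // _; exact: sqr_cabs_ge0.
have DL2 N : L2 mu (fun v => f v - truncation f N v).
  apply/L2P; apply: le_lt_trans f_L2; apply: ge0_le_integral => //.
  - by move=> v _; rewrite lee_fin; exact: D0.
  - by move=> v _; rewrite lee_fin; exact: Df.
have D_cvg : {ae mu, forall v, [set: vertex] v ->
    (fun N => (D N v)%:E) @ \oo --> (cst 0 v : \bar R)}.
  apply: aeW => v _; apply: cvg_near_cst.
  case: v => [|i j]; first by near=> N; rewrite DE.
  near=> N; rewrite DE /=.
  have -> : (i < N)%N by near: N; exact: nbhs_infty_gt.
  by have -> : (j < N)%N by near: N; exact: nbhs_infty_gt.
have f_int : mu.-integrable setT (fun v => (cabs (f v) ^+ 2)%:E).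
  apply/integrableP; split; first exact: vertex_measurable_fun.
  by under eq_integral do rewrite /= ger0_norm ?sqr_cabs_ge0//.
have D_dom : {ae mu, forall v N, [set: vertex] v ->
    (`|(D N v)%:E| <= (cabs (f v) ^+ 2)%:E)%E}.
  by apply: aeW => v N _; rewrite /= ger0_norm ?lee_fin.
have [_ _] := dominated_convergence measurableT (fun=> @vertex_measurable_fun _ _ _ _)
  (@vertex_measurable_fun _ _ _ _) D_cvg f_int D_dom.
rewrite integral_cst// mul0e => D_lim.
have e20 : 0 < e ^+ 2 by rewrite exprn_gt0.
move/fine_cvgP : D_lim => [_ /cvgrPdist_lt /(_ _ e20)[N _ /(_ N (leqnn N)) /=]].
have DN := sqr_L2norm (DL2 N); rewrite -DN /= sub0r normrN => /ltr_normlW DNe.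
exists (truncation f N); first exact: dom_infty_truncation.
by rewrite -(@ltr_pXn2r _ 2)// ?nnegrE ?sqrtr_ge0 ?ltW.
Unshelve. all: by end_near. Qed.

Lemma generates_Stieltjes_composition_op : generates_Stieltjes mu C_phi.
Proof. by split; [exact: dense_dom_infty|exact: Stieltjes_sqr_norms]. Qed.

Definition delta (y v : vertex) : R[i] := if v == y then 1 else 0.

Lemma sqr_cabs_delta y v : cabs (delta y v) ^+ 2 = (v \in [set y])%:R.
Proof.
rewrite /delta; have [->|vy] := eqVneq v y.
  by rewrite cabs1 expr1n mem_set.
by rewrite cabs0 expr0n memNset//= => /eqP; exact/negP.
Qed.

Lemma integral_delta_iter y n :
  (\int[mu]_v (cabs (delta y (iter n phi v)) ^+ 2)%:E = mu (iter n phi @^-1` [set y]))%E.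
Proof.
rewrite graph_measure_preimage -(integral_graph_iter n (f := fun v => (v \in [set y])%:R)).
  by apply: eq_integral => v _; rewrite sqr_cabs_delta.
by move=> v; rewrite ler0n.
Qed.

Lemma dom_delta y : dom C_phi (delta y).
Proof.
split; apply/L2P.
- rewrite (integral_delta_iter y 0); exact: graph_measure1_lty.
- rewrite (integral_delta_iter y 1).
  by case: y => [|i j]; rewrite ?graph_measure_preimage_X0 ?graph_measure_preimage_Xarm ltry.
Qed.

Lemma Rintegral_point y (c : R) :
  (\int[mu]_v (if v == y then c else 0))%R = c * fine (mu [set y]).
Proof.
rewrite /Rintegral.
have -> : (\int[mu]_v (if v == y then c else 0)%:E = \int[mu]_(v in [set y]) c%:E)%E.
  rewrite [RHS]integral_mkcond; apply: eq_integral => v _; rewrite patchE.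
  have [->|vy] := eqVneq v y; first by rewrite mem_set.
  by rewrite memNset//= => /eqP; exact/negP.
rewrite integral_cst//= fineM//.
by rewrite ge0_fin_numE// graph_measure1_lty.
Qed.

Lemma sqr_Re_le (z : R[i]) : complex.Re z ^+ 2 <= cabs z ^+ 2.
Proof.
case: z => p q /=; rewrite sqr_sqrtr ?addr_ge0 ?sqr_ge0//.
by rewrite lerDl sqr_ge0.
Qed.

(** Testing with the indicator of [X0], the adjoint sends the indicator of
    [Xarm 0 0] to a function whose value at [X0] has the real part [a 0], so that
    the square of its norm is at least [a 0 ^+ 2]; the operator sends the same
    indicator to that of [Xarm 0 1], of squared norm [a 0 * s 0]. *)
Lemma not_hyponormal_composition_op : s 0%N < a 0%N -> ~ hyponormal mu C_phi.
Proof.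
move=> s0a0 [_ dom_sub /(_ (delta (Xarm 0 0)))].
have /dom_sub[_ [h0 adj0]] := dom_delta (Xarm 0 0).
move=> /(_ (dom_delta _)).
have : is_adjoint mu C_phi (delta (Xarm 0 0)) (adjoint mu C_phi (delta (Xarm 0 0))).
  by apply: xgetPex; exists h0.
move: (adjoint _ _ _) => h [h_L2 /(_ (delta X0) (dom_delta _))].
rewrite /L2inner => -[+ _].
rewrite (_ : (fun v => complex.Re (C_phi (delta X0) v * ((delta (Xarm 0 0) v)^*)%C)) =
             (fun v => if v == Xarm 0 0 then 1 else 0)); last first.
  apply/funext => v; rewrite /delta; have [->|_] := eqVneq v (Xarm 0 0).
    by rewrite conjc1 mulr1.
  by rewrite conjc0 mulr0.
rewrite (_ : (fun v => complex.Re (delta X0 v * ((h v)^*)%C)) =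
             (fun v => if v == X0 then complex.Re (h X0) else 0)); last first.
  apply/funext => v; rewrite /delta; have [->|_] := eqVneq v X0.
    by rewrite mul1r; case: (h X0).
  by rewrite mul0r.
rewrite !Rintegral_point graph_measure1_X0 graph_measure1_Xarm /= mulr1 mul1r.
rewrite /arm_weight expr0 mulr1 => a0E.
apply/negP; rewrite -ltNge -(@ltr_pXn2r _ 2)// ?nnegrE ?sqrtr_ge0//.
rewrite -lte_fin !sqr_L2norm//; last by have [] := dom_delta (Xarm 0 0).
rewrite (integral_delta_iter (Xarm 0 0) 1) graph_measure_preimage_Xarm.
apply: (@lt_le_trans _ _ ((a 0%N) ^+ 2)%:E).
  by rewrite lte_fin /arm_weight expr0 mulr1 expr1 expr2 ltr_pM2l.
apply: (@le_trans _ _ (\int[mu]_(v in [set X0]) (cabs (h v) ^+ 2)%:E)%E); last first.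
  apply: ge0_subset_integral => //.
  by move=> v _; rewrite lee_fin sqr_cabs_ge0.
rewrite (_ : (\int[mu]_(v in [set X0]) _)%E = (\int[mu]_(v in [set X0]) (cabs (h X0) ^+ 2)%:E)%E).
  by rewrite integral_cst// graph_measure1_X0 mule1 lee_fin a0E sqr_Re_le.
by apply: eq_integral => v; rewrite inE => ->.
Qed.


End geometric_arms.

Theorem theorem5p5p1 (R : realType) :
  exists mu : {measure set vertex -> \bar R},
    discrete_measure mu /\
    [/\ injective_op (composition_op mu phi_infty0) /\
          generates_Stieltjes mu (composition_op mu phi_infty0),
        ~ hyponormal mu (composition_op mu phi_infty0),
        exists gamma : nat -> R,
          [/\ forall n : nat, h_ mu phi_infty0 n X0 = (gamma n)%:E,
              Stieltjes gamma, H_determinate gamma &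
              has_index gamma 0 0%E] &
        forall x : vertex, x <> X0 ->
          exists gamma : nat -> R,
            [/\ forall n : nat, h_ mu phi_infty0 n x = (gamma n)%:E,
                Stieltjes gamma, H_determinate gamma &
                infinite_index gamma]].
Proof.
pose r : R := 8; pose a : R := 16.
have r1 : 1 < r by rewrite /r; lra.
have ra : r < a by rewrite /r /a; lra.
have ar2 : a < r ^+ 2 by rewrite /r /a; lra.
have r0 : 0 < r by lra.
have a0 : 0 < a by lra.
have ar1 : 1 < a * r by nra.
have arr : a < r * r by rewrite -expr2.
have v0 i : 0 < nweight a r r a i.
  by rewrite mulr_gt0 ?weight_gt0// divr_gt0// wmom0_gt0.
have s0 i : 0 < node r r i by exact: node_gt0.
have w0 i : 0 <= nweight 1 r a 1 i by exact: nweight_ge0.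
have x0 i : 0 <= node r a i by exact: node_ge0.
have g0 : nmom 1 r a 1 0 = 1 by exact: nmom0.
have gP : atomic_moments (nweight 1 r a 1) (node r a) (nmom 1 r a 1).
  exact: atomic_moments_nweight.
have gS : atomic_moments (nweight a r r a) (node r r)
    (fun n => nmom 1 r a 1 n.+1 - nmom 1 r a 1 n).
  by move=> n; rewrite nmom_diff//; apply: atomic_moments_nweight => //; exact: ltW.
have r_lt : node r r 0 < nweight a r r a 0.
  have := first_nweight_ge r1 a0 ar2; rewrite node0 /r /a.
  by move: (nweight _ _ _ _ _) => c; lra.
exists (graph_measure (nweight a r r a) (node r r)); split.
  exact: (discrete_graph_measure v0 s0 g0 gS).
split.
- split; first exact: injective_composition_op.
  exact: (generates_Stieltjes_composition_op v0 s0 w0 x0 g0 gP gS).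
- exact: (not_hyponormal_composition_op v0 s0 g0 gS r_lt).
- exists (nmom 1 r a 1); split.
  + exact: (h_X0 v0 s0 g0 gS).
  + by exists (pmeasure 1 r a 1); exact: S_representing_pmeasure.
  + by apply: H_determinate_nmom => //; rewrite mul1r.
  + exact: has_index_nmom.
- case=> [//|i j] _; have si := ltW (s0 i).
  have sE : (fun n => node r r i ^+ n) = (fun n => 1 * node r r i ^+ n).
    by apply/funext => n; rewrite mul1r.
  exists (fun n => node r r i ^+ n); split.
  + move=> n; exact: (h_Xarm v0 s0 g0 gS).
  + by rewrite sE; exists (point_measure 1 (node r r i)); exact: S_representing_point.
  + by rewrite sE; exact: H_determinate_point.
  + exact: infinite_index_point.
Qed.
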